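(* Suppose Assumptions (A1)–(A4) hold, and let $\kappa_2,\alpha,\beta,\eta$ and $\epsilon_1,\dots,\epsilon_8$ be exactly as in Theorem 1 (i.e. $\kappa_2>1$, $\beta>\max\{\frac{\kappa_1}{\kappa_2-1},\kappa_3,\kappa_4\}$, $\alpha\in(\beta+\kappa_1,\kappa_2\beta]$, $\eta\in(0,\min\{\epsilon_1/\epsilon_2,\epsilon_3/\epsilon_4,\epsilon_5/\epsilon_6\})$). Define $\epsilon_9=\min\{\frac{1}{2\rho(L)},\frac{\alpha-\beta}{2\alpha}\}$, $\epsilon_{10}=\eta\min\{\epsilon_1-\eta\epsilon_2,\ \epsilon_3-\eta\epsilon_4,\ \frac\nu2\}$, $\epsilon=\epsilon_{10}/\epsilon_8$, $c=\epsilon_8\hat V_0/\epsilon_9$. Let $\{\boldsymbol x_k\}$ be generated by Algorithm 1. Then for all $k\in\mathbb N_0$, $$\|\boldsymbol x_k-\bar{\boldsymbol x}_k\|^2+n(f(\bar x_k)-f^* )\le(1-\epsilon)^kc.$$ Moreover, if the projection $\mathcal P_{\mathbb X^*}(x)=\arg\min_{y\in\mathbb X^*}\|x-y\|^2$ is well defined for all $x$, then for all $k\in\mathbb N_0$, $$\|\boldsymbol x_k-\mathbf 1_n\otimes\mathcal P_{\mathbb X^*}(\bar x_k)\|^2\le(1-\epsilon)^kc\Big(1+\frac{1}{2\nu}\Big).$$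
   Context: Same setting as Theorem 1: graph $\mathcal G$ with Laplacian $L$, $\rho(L)$ largest eigenvalue, $\rho_2(L)$ smallest positive eigenvalue; $f=\frac1n\sum_i f_i$, $\mathbb X^*=\arg\min f$, $f^*=\min f$. Assumptions: (A1) $\mathcal G$ connected; (A2) $\mathbb X^*\ne\emptyset$, $f^*>-\infty$; (A3) each $\nabla f_i$ is $L_f$-Lipschitz; (A4) $f$ satisfies the Polyak–Łojasiewicz condition with constant $\nu>0$: $\frac12\|\nabla f(x)\|^2\ge\nu(f(x)-f^* )$ for all $x\in\mathbb R^p$. Constants from Theorem 1: $\kappa_1=\frac{2+3L_f^2}{2\rho_2(L)}$, $\kappa_3=\frac14(1+(1+8\kappa_2+\frac{8}{\rho_2(L)})^{1/2})$, $\kappa_4=(\kappa_2+\frac1{\rho_2(L)})L_f^2+((\kappa_2+\frac1{\rho_2(L)})^2L_f^2+2)^{1/2}L_f$, $\epsilon_1=(\alpha-\beta)\rho_2(L)-\frac12(2+3L_f^2)$, $\epsilon_2=\beta^2\rho(L)+(2\alpha^2+\beta^2)\rho^2(L)+\frac52L_f^2$, $\epsilon_3=\beta-\frac12-\frac\alpha{2\beta^2}-\frac1{2\beta\rho_2(L)}$, $\epsilon_4=2\beta^2+\frac12$, $\epsilon_5=\frac14-\frac1{2\beta}(\frac1\beta+\frac1{\rho_2(L)}+\frac\alpha\beta)L_f^2$, $\epsilon_6=\frac1{\beta^2}(1+\frac1{\rho_2(L)}+\frac\alpha\beta)L_f^2+\frac{L_f(1+L_f)}2$, $\epsilon_8=\frac{\alpha+\beta}{2\beta}+\frac1{2\rho_2(L)}$.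 Algorithm 1: $x_{i,0}$ arbitrary, $\sum_j v_{j,0}=\mathbf 0_p$, $x_{i,k+1}=x_{i,k}-\eta(\alpha\sum_jL_{ij}x_{j,k}+\beta v_{i,k}+\nabla f_i(x_{i,k}))$, $v_{i,k+1}=v_{i,k}+\eta\beta\sum_jL_{ij}x_{j,k}$. Notation: $\boldsymbol x_k=\mathrm{col}(x_{i,k})$, $\boldsymbol v_k=\mathrm{col}(v_{i,k})$, $\bar x_k=\frac1n\sum_ix_{i,k}$, $\bar{\boldsymbol x}_k=\mathbf 1_n\otimes\bar x_k$, $\boldsymbol K=(I_n-\frac1n\mathbf 1\mathbf 1^\top)\otimes I_p$, $\|z\|^2_M=z^\top Mz$, $\boldsymbol g_k^0=\mathrm{col}(\nabla f_1(\bar x_k),\dots,\nabla f_n(\bar x_k))$, $\hat V_0=\|\boldsymbol x_0\|^2_{\boldsymbol K}+\|\boldsymbol v_0+\frac1\beta\boldsymbol g_0^0\|^2_{\boldsymbol K}+n(f(\bar x_0)-f^* )$. *)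

(* Defs.v *)
From mathcomp Require Import ssreflect ssrfun ssrbool eqtype ssrnat seq fintype bigop.
From Stdlib Require Import Reals.
Open Scope R_scope.

Definition sumR (m : nat) (F : 'I_m -> R) : R := \big[Rplus/0]_(i < m) F i.

Definition vec (p : nat) := 'I_p -> R.
Definition vadd {p} (x y : vec p) : vec p := fun l => x l + y l.
Definition vsub {p} (x y : vec p) : vec p := fun l => x l - y l.
Definition vscal {p} (c : R) (x : vec p) : vec p := fun l => c * x l.
Definition dot {p} (x y : vec p) : R := sumR p (fun l => x l * y l).
Definition norm2 {p} (x : vec p) : R := dot x x.
Definition norm {p} (x : vec p) : R := sqrt (norm2 x).

Definition svec (n p : nat) := 'I_n -> vec p.
Definition snorm2 {n p} (z : svec n p) : R := sumR n (fun i => norm2 (z i)).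
(* z^T K z with K = (I_n - (1/n) 1 1^T) (x) I_p *)
Definition Kform {n p} (z : svec n p) : R :=
  sumR n (fun i => sumR n (fun j =>
     ((if i == j then 1 else 0) - / INR n) * dot (z i) (z j))).
Definition avg {n p} (z : svec n p) : vec p :=
  fun l => / INR n * sumR n (fun i => z i l).
Definition stack {n p} (y : vec p) : svec n p := fun _ => y.

Definition is_gradient {p} (F : vec p -> R) (G : vec p -> vec p) : Prop :=
  forall (x : vec p) (eps : R), 0 < eps ->
    exists delta, 0 < delta /\
      forall h : vec p, norm h < delta ->
        Rabs (F (vadd x h) - F x - dot (G x) h) <= eps * norm h.

Definition lipschitz {p} (G : vec p -> vec p) (Lc : R) : Prop :=
  forall x y : vec p, norm (vsub (G x) (G y)) <= Lc * norm (vsub x y).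

Definition undirected_weighted {n} (a : 'I_n -> 'I_n -> R) : Prop :=
  (forall i j, 0 <= a i j) /\ (forall i j, a i j = a j i) /\ (forall i, a i i = 0).

Inductive reach {n} (a : 'I_n -> 'I_n -> R) (i : 'I_n) : 'I_n -> Prop :=
| reach_refl : reach a i i
| reach_step : forall j k, reach a i j -> 0 < a j k -> reach a i k.

Definition connected {n} (a : 'I_n -> 'I_n -> R) : Prop := forall i j, reach a i j.

Definition laplacian {n} (a : 'I_n -> 'I_n -> R) : 'I_n -> 'I_n -> R :=
  fun i j => (if i == j then sumR n (fun k => a i k) else 0) - a i j.

Definition is_eigenvalue {n} (M : 'I_n -> 'I_n -> R) (lam : R) : Prop :=
  exists v : 'I_n -> R, (exists i, v i <> 0) /\
    forall i, sumR n (fun j => M i j * v j) = lam * v i.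

Definition is_largest_eig {n} (M : 'I_n -> 'I_n -> R) (r : R) : Prop :=
  is_eigenvalue M r /\ forall lam, is_eigenvalue M lam -> lam <= r.

Definition is_smallest_pos_eig {n} (M : 'I_n -> 'I_n -> R) (r : R) : Prop :=
  0 < r /\ is_eigenvalue M r /\
  forall lam, is_eigenvalue M lam -> 0 < lam -> r <= lam.

Section Consts.
Variables (Lf rho rho2 nu alpha beta kappa2 eta : R).
Definition kappac1 := (2 + 3 * Lf ^ 2) / (2 * rho2).
Definition kappac3 := / 4 * (1 + sqrt (1 + 8 * kappa2 + 8 / rho2)).
Definition kappac4 := (kappa2 + / rho2) * Lf ^ 2
  + sqrt ((kappa2 + / rho2) ^ 2 * Lf ^ 2 + 2) * Lf.
Definition epsc1 := (alpha - beta) * rho2 - / 2 * (2 + 3 * Lf ^ 2).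
Definition epsc2 := beta ^ 2 * rho + (2 * alpha ^ 2 + beta ^ 2) * rho ^ 2 + 5 / 2 * Lf ^ 2.
Definition epsc3 := beta - / 2 - alpha / (2 * beta ^ 2) - / (2 * beta * rho2).
Definition epsc4 := 2 * beta ^ 2 + / 2.
Definition epsc5 := / 4 - / (2 * beta) * (/ beta + / rho2 + alpha / beta) * Lf ^ 2.
Definition epsc6 := / beta ^ 2 * (1 + / rho2 + alpha / beta) * Lf ^ 2 + Lf * (1 + Lf) / 2.
Definition epsc8 := (alpha + beta) / (2 * beta) + / (2 * rho2).
Definition epsc9 := Rmin (/ (2 * rho)) ((alpha - beta) / (2 * alpha)).
Definition epsc10 := eta * Rmin (Rmin (epsc1 - eta * epsc2) (epsc3 - eta * epsc4)) (nu / 2).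
Definition epsT := epsc10 / epsc8.
End Consts.

(* Main.v *)
Require Import Defs.
From mathcomp Require Import ssreflect ssrfun ssrbool eqtype ssrnat seq fintype bigop.
From Stdlib Require Import Reals.
From mathcomp Require ssralg ssrnum zmodp matrix sesquilinear spectral complex.
From mathcomp Require Import Rstruct.
From Stdlib Require Import Lra Lia FunctionalExtensionality.
Open Scope R_scope.

(** In an eigenbasis of the Laplacian every consensus quantity decouples into
scalar modes.  For a mode with eigenvalue [lam], let [x] and [w] be the
coordinates of the iterate and of [v + g0 / beta], and put
[modeV = x^2/2 + (1/lam + alpha/beta) w^2/2 + x w].  The Lyapunov function is
the sum of [modeV] over all modes plus [theta * n * (f xbar - fstar)], whose
decrease is a scalar inequality for each mode, the descent lemma for [f] at the
average, and the Polyak-Lojasiewicz inequality.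

The PL condition only gives [|z - P z|^2 <= (2 / nu) (f z - fstar)], not the
factor [1 / (2 nu)] of the second claim.  The weight [theta = max (1, 4 eps9)]
compensates for the missing factor 4: the decrease still holds because
[theta <= 2], and [theta <= eps8] leaves the initial bound unchanged. *)

(** At a consensus equilibrium [beta * v] cancels the local gradients, which is why the dual
    variable is shifted to [v + g0 / beta]. After the shift the primal update sees only the gradient
    error [g - g0], which the Lipschitz condition bounds by the disagreement of the iterate. The
    price is the drift of [g0], bounded by the movement of the average. Neither half of the Lyapunov
    function decreases alone: the drift is paid by the negative squared averaged gradient in the
    descent lemma, and the error in the averaged gradient is paid by the decrease of the
    disagreement. The growth bound with constant [2 / nu] has to be obtained without convexity. The
    path length of the gradient flow would give it; gradient descent with step [h] replaces the
    flow, avoids a differential equation, and loses only a factor tending to 1 with [h]. *)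

(** * Real eigenframe of a symmetric matrix, from the complex spectral theorem *)

Module Spectral.
Import ssralg ssrnum zmodp matrix sesquilinear spectral complex.
Import GRing.Theory Num.Theory.
Local Open Scope ring_scope.
Local Open Scope complex_scope.
Local Open Scope sesquilinear_scope.

(* The [n + n] vectors are the real and imaginary parts of a complex unitary
   eigenbasis; a Parseval frame is all that is needed of an orthonormal basis. *)
Lemma symmetric_eigenframe (F : rcfType) (n : nat) (M : 'I_n -> 'I_n -> F) :
  (forall i j, M i j = M j i) ->
  exists (e : 'I_(n + n) -> 'I_n -> F) (lam : 'I_(n + n) -> F),
    (forall m j, \sum_i M j i * e m i = lam m * e m j) /\
    (forall z : 'I_n -> F,
       \sum_m (\sum_i e m i * z i) ^+ 2 = \sum_i z i ^+ 2).
Proof.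
move=> Msym; pose A : 'M[F]_n := \matrix_(i, j) M i j.
have Asym : A^T = A by apply/matrixP => i j; rewrite !mxE.
pose B : 'M[F[i]]_n := map_mx (real_complex F) A.
have Breal : B \is a realmx.
  by apply/mxOverP => i j; rewrite mxE complex_real.
have Bherm : B \is hermsymmx.
  apply: realsym_hermsym => //.
  by apply/is_hermitianmxP; rewrite expr0 scale1r map_mx_id // /B map_trmx Asym.
set P := spectralmx B; set D := spectral_diag B.
have Pu : P \is unitarymx := spectral_unitarymx B.
have PB : P *m B = diag_mx D *m P.
  have /hermitian_normalmx/orthomx_spectralP BE := Bherm.
  by rewrite {1}BE -mulmxA mulKVmx // spectral_unit.
have Dreal m : D 0 m = (complex.Re (D 0 m))%:C.
  have /mxOverP/(_ 0 m) := hermitian_spectral_diag_real Bherm.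
  by move=> H; rewrite RRe_real.
(* Matrix and eigenvalues are real, so this equation splits: the real and the imaginary part of each
   row of [P] both satisfy it, though one of them may be zero. *)
have key m j : \sum_i P m i * (A j i)%:C = (complex.Re (D 0 m))%:C * P m j.
  have /matrixP/(_ m j) := PB; rewrite mul_diag_mx !mxE -Dreal => <-.
  by apply: eq_bigr => i _; rewrite [B _ _]mxE -[in LHS]Asym [(A^T)%R _ _]mxE.
have ReS (I : finType) (G : I -> F[i]) :
    complex.Re (\sum_i G i) = \sum_i complex.Re (G i).
  by apply: (big_morph (@complex.Re F)) => // [[a b] [c d]].
have ImS (I : finType) (G : I -> F[i]) :
    complex.Im (\sum_i G i) = \sum_i complex.Im (G i).
  by apply: (big_morph (@complex.Im F)) => // [[a b] [c d]].
have ReM (u : F[i]) (t : F) : complex.Re (u * t%:C) = complex.Re u * t.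
  by case: u => a b /=; rewrite mulr0 subr0.
have ImM (u : F[i]) (t : F) : complex.Im (u * t%:C) = complex.Im u * t.
  by case: u => a b /=; rewrite mulr0 add0r.
exists (fun m i => match fintype.split m with
          | inl m' => complex.Re (P m' i) | inr m' => complex.Im (P m' i) end).
exists (fun m => match fintype.split m with
          | inl m' => complex.Re (D 0 m') | inr m' => complex.Re (D 0 m') end).
split.
  move=> m j; case: (fintype.split m) => m'.
    have /(congr1 (@complex.Re F)) := key m' j.
    rewrite ReS [in RHS]mulrC ReM [RHS]mulrC => <-.
    by apply: eq_bigr => i _; rewrite ReM mulrC mxE.
  have /(congr1 (@complex.Im F)) := key m' j.
  rewrite ImS [in RHS]mulrC ImM [RHS]mulrC => <-.
  by apply: eq_bigr => i _; rewrite ImM mulrC mxE.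
move=> z; rewrite big_split_ord /=.
under eq_bigr => m _.
  under eq_bigr => i _ do rewrite (unsplitK (inl m)).
  over.
under [X in _ + X = _]eq_bigr => m _.
  under eq_bigr => i _ do rewrite (unsplitK (inr m)).
  over.
rewrite -big_split /=.
pose y : 'cV[F[i]]_n := \col_i (z i)%:C.
(* Unitarity preserves the norm of [y], and the squared modulus of each coordinate of [P *m y] is
   the sum of the two squares contributed by the two halves of the frame. *)
have : (P *m y)^t* *m (P *m y) = y^t* *m y.
  rewrite trmx_mul map_mxM -mulmxA [_^t* *m (P *m y)]mulmxA.
  by rewrite -[P^t*](invmx_unitary Pu) mulVmx ?mul1mx // unitarymx_unit.
move=> /matrixP/(_ 0 0); rewrite !mxE.
have yE i : (y^t*) 0 i * y i 0 = (z i ^+ 2)%:C.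
  by rewrite !mxE conj_Creal ?complex_real // -rmorphM expr2.
rewrite (eq_bigr _ (fun i _ => yE i)) -rmorph_sum => E; apply: (@complexI F).
rewrite -{}E rmorph_sum; apply: eq_bigr => m _.
rewrite mxE mxE mulrC -sqr_normc -add_Re2_Im2 mxE ReS ImS; congr ((_ ^+2 + _ ^+ 2)%:C);
  by apply: eq_bigr => i _; rewrite mxE ?ReM ?ImM.
Qed.
End Spectral.

(** * Finite sums of reals *)

Lemma eq_sumR n (F G : 'I_n -> R) : (forall i, F i = G i) -> sumR n F = sumR n G.
Proof. by move=> H; apply: eq_bigr => i _. Qed.

Lemma sumRD n (F G : 'I_n -> R) :
  sumR n (fun i => F i + G i) = sumR n F + sumR n G.
Proof. exact: big_split. Qed.

Lemma sumR_mull n c (F : 'I_n -> R) : sumR n (fun i => c * F i) = c * sumR n F.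
Proof. by rewrite /sumR big_distrr. Qed.

Lemma sumR_mulr n c (F : 'I_n -> R) : sumR n (fun i => F i * c) = sumR n F * c.
Proof. by rewrite /sumR big_distrl. Qed.

Lemma sumRB n (F G : 'I_n -> R) :
  sumR n (fun i => F i - G i) = sumR n F - sumR n G.
Proof.
have -> : sumR n F - sumR n G = sumR n F + -1 * sumR n G by ring.
by rewrite -sumR_mull -sumRD; apply: eq_sumR => i; ring.
Qed.

Lemma sumR0 n (F : 'I_n -> R) : (forall i, F i = 0) -> sumR n F = 0.
Proof. by move=> H; rewrite /sumR big1. Qed.

Lemma sumR_const n c : sumR n (fun _ => c) = INR n * c.
Proof.
elim: n => [|n IH]; first by rewrite /sumR big_ord0 /=; ring.
by rewrite /sumR big_ord_recr /= [\big[_/_]_(i < n) _]IH -/(INR n.+1) S_INR; ring.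
Qed.

Lemma sumR_le n (F G : 'I_n -> R) :
  (forall i, F i <= G i) -> sumR n F <= sumR n G.
Proof.
by move=> H; rewrite /sumR; apply: (big_ind2 Rle) => // *; lra.
Qed.

Lemma sumR_ge0 n (F : 'I_n -> R) : (forall i, 0 <= F i) -> 0 <= sumR n F.
Proof. by move=> H; rewrite -(sumR0 n (fun=> 0)) //; apply: sumR_le. Qed.

Lemma sumR_term_le n (F : 'I_n -> R) j :
  (forall i, 0 <= F i) -> F j <= sumR n F.
Proof.
move=> H; rewrite /sumR (bigD1 j) //=.
have : 0 <= \big[Rplus/0]_(i < n | i != j) F i.
  by apply: big_ind => // *; lra.
by move=> ?; rewrite -[X in X <= _]Rplus_0_r; apply: Rplus_le_compat_l.
Qed.

Lemma sumR_eq0 n (F : 'I_n -> R) :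
  (forall i, 0 <= F i) -> sumR n F = 0 -> forall i, F i = 0.
Proof. by move=> H E i; have := sumR_term_le n F i H; have := H i; lra. Qed.

Lemma exchange_sumR n m (F : 'I_n -> 'I_m -> R) :
  sumR n (fun i => sumR m (fun j => F i j)) =
  sumR m (fun j => sumR n (fun i => F i j)).
Proof. exact: exchange_big. Qed.

Lemma sumR_delta n (F : 'I_n -> R) i :
  sumR n (fun j => (if i == j then 1 else 0) * F j) = F i.
Proof.
rewrite /sumR (bigD1 i) //= eqxx big1 => [|j]; first by ring.
by rewrite eq_sym => /negPf ->; ring.
Qed.

Lemma sumR_sqr_dev n (z : 'I_n -> R) : 0 < INR n ->
  sumR n (fun i => (z i - / INR n * sumR n z) ^ 2) =
  sumR n (fun i => z i ^ 2) - / INR n * sumR n z ^ 2.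
Proof.
move=> n0; set s := sumR n z; set c := / INR n * s.
transitivity (sumR n (fun i => z i ^ 2) + (- 2 * c) * sumR n z + sumR n (fun=> c ^ 2)).
  by rewrite -sumR_mull -!sumRD; apply: eq_sumR => i; ring.
rewrite sumR_const -/s /c; field; lra.
Qed.

Lemma symmetric_eigenframeR n (M : 'I_n -> 'I_n -> R) :
  (forall i j, M i j = M j i) ->
  exists (e : 'I_(n + n) -> 'I_n -> R) (lam : 'I_(n + n) -> R),
    (forall m j, sumR n (fun i => M j i * e m i) = lam m * e m j) /\
    (forall z : 'I_n -> R,
       sumR (n + n) (fun m => sumR n (fun i => e m i * z i) ^ 2) =
       sumR n (fun i => z i ^ 2)).
Proof.
move=> Msym.
have [e [lam [He Hz]]] := Spectral.symmetric_eigenframe _ n M Msym.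
exists e, lam; split => [m j|z].
  exact: He.
have := Hz z; rewrite /sumR => E.
etransitivity; last (etransitivity; first exact: E).
  by apply: eq_bigr => m _; rewrite /= Rmult_1_r.
by apply: eq_bigr => m _; rewrite /= Rmult_1_r.
Qed.

(** * The graph Laplacian: energy, kernel and eigenframe *)

Lemma laplacian_rowsum n (a : 'I_n -> 'I_n -> R) i :
  sumR n (fun j => laplacian a i j) = 0.
Proof.
rewrite sumRB; set s := sumR n (fun k => a i k).
rewrite (eq_sumR n _ (fun j => (if i == j then 1 else 0) * s)).
  by rewrite sumR_delta; ring.
by move=> j; case: ifP => _; ring.
Qed.

Lemma laplacian_sym n (a : 'I_n -> 'I_n -> R) : undirected_weighted a ->
  forall i j, laplacian a i j = laplacian a j i.
Proof.
by move=> [_ [sa _]] i j; rewrite /laplacian sa eq_sym; case: eqP => [->|].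
Qed.

(** The Dirichlet energy; each edge occurs twice in the double sum, hence the factor 2. It makes
    eigenvalues nonnegative and identifies the kernel. *)
Lemma laplacian_form n (a : 'I_n -> 'I_n -> R) (u : 'I_n -> R) :
  undirected_weighted a ->
  2 * sumR n (fun i => u i * sumR n (fun j => laplacian a i j * u j)) =
  sumR n (fun i => sumR n (fun j => a i j * (u i - u j) ^ 2)).
Proof.
move=> [_ [sa _]].
have E i : sumR n (fun j => laplacian a i j * u j) =
           sumR n (fun j => a i j * (u i - u j)).
  rewrite /laplacian; set s := sumR n (fun k => a i k).
  transitivity (sumR n (fun j => (if i == j then 1 else 0) * (s * u j))
                - sumR n (fun j => a i j * u j)).
    by rewrite -sumRB; apply: eq_sumR => j; case: ifP => _; ring.
  rewrite sumR_delta -sumR_mulr -sumRB; apply: eq_sumR => j; ring.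
rewrite (eq_sumR _ _ (fun i => sumR n (fun j => a i j * (u i ^ 2 - u i * u j)))).
  have -> : forall t, 2 * t = t + t by move=> t; ring.
  rewrite [X in _ + X]exchange_sumR -sumRD; apply: eq_sumR => i.
  by rewrite -sumRD; apply: eq_sumR => j; rewrite (sa j i); ring.
by move=> i; rewrite E -sumR_mull; apply: eq_sumR => j; ring.
Qed.

(** Zero energy kills every edge term, so [u] agrees across each edge, and then along each path. *)
Lemma laplacian_ker n (a : 'I_n -> 'I_n -> R) (u : 'I_n -> R) :
  undirected_weighted a -> connected a ->
  (forall i, sumR n (fun j => laplacian a i j * u j) = 0) ->
  forall i j, u i = u j.
Proof.
move=> Ha Hc Hu; have [a0 [sa _]] := Ha.
have := laplacian_form n a u Ha.
rewrite [sumR n (fun i => u i * _)]sumR0 => [E|i]; last by rewrite Hu; ring.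
have T0 i j : 0 <= a i j * (u i - u j) ^ 2.
  by apply: Rmult_le_pos => //; apply: pow2_ge_0.
have edge j k : 0 < a j k -> u j = u k.
  move=> ajk.
  have R0 := sumR_eq0 n _ (fun i => sumR_ge0 n _ (T0 i)) _ j.
  have Z : a j k * (u j - u k) ^ 2 = 0.
    by apply: (sumR_eq0 n _ (T0 j)); apply: R0; lra.
  have /Rmult_integral[|Z2] := Z; first by lra.
  have : u j - u k = 0 by apply: Rsqr_0_uniq; rewrite Rsqr_pow2.
  by lra.
by move=> i j; elim: (Hc i j) => // k l _ -> /edge.
Qed.

(* A Parseval frame of mean-zero eigenvectors: in the coordinates
   z |-> sum_i e m i * z i the Laplacian and the projection K both become
   diagonal, so the Lyapunov estimate reduces to a scalar one.  Discarded
   (zero) vectors get the dummy eigenvalue rho. *)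
Lemma laplacian_eigenframe n (a : 'I_n -> 'I_n -> R) rho rho2 :
  undirected_weighted a -> connected a ->
  is_largest_eig (laplacian a) rho ->
  is_smallest_pos_eig (laplacian a) rho2 ->
  exists (N : nat) (e : 'I_N -> 'I_n -> R) (lam : 'I_N -> R),
    (forall m, rho2 <= lam m <= rho) /\
    (forall m j, sumR n (fun i => laplacian a j i * e m i) = lam m * e m j) /\
    (forall z : 'I_n -> R,
       sumR N (fun m => sumR n (fun i => e m i * z i) ^ 2) =
       sumR n (fun i => (z i - / INR n * sumR n z) ^ 2)).
Proof.
move=> Ha Hc [Hrho rho_max] [rho2_gt0 [Hrho2 rho2_min]].
have n0 : 0 < INR n.
  case: Hrho => v [[i _] _]; apply: lt_0_INR; apply/ltP.
  exact: leq_ltn_trans (ltn_ord i).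
have [e [lam [He Hz]]] := symmetric_eigenframeR n (laplacian a) (laplacian_sym n a Ha).
pose good m := (lam m != 0) && [exists i, e m i != 0].
exists (addn n n), (fun m i => if good m then e m i else 0),
  (fun m => if good m then lam m else rho).
split; [|split].
- move=> m; case: ifP => [/andP[/eqP l0 /existsP[i /eqP ei]]|_]; last first.
    by split; [apply: rho_max | lra].
  have El : is_eigenvalue (laplacian a) (lam m) by exists (e m); split; [exists i|].
  split; last exact: rho_max.
  apply: rho2_min => //.
  (* Nonnegative energy and [e m <> 0] exclude negative eigenvalues, and [good] excludes 0; hence
     [lam m] is positive and [rho2_min] applies. *)
  have := laplacian_form n a (e m) Ha.
  rewrite (eq_sumR n (fun i => e m i * _) (fun i => lam m * e m i ^ 2)); last first.
    by move=> j; rewrite He; ring.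
  rewrite sumR_mull => E.
  have Q0 : 0 <= sumR n (fun i => sumR n (fun j => a i j * (e m i - e m j) ^ 2)).
    apply: sumR_ge0 => k; apply: sumR_ge0 => j; apply: Rmult_le_pos.
      by case: Ha.
    exact: pow2_ge_0.
  have := sumR_term_le n (fun i => e m i ^ 2) i (fun i => pow2_ge_0 _).
  have : 0 < e m i ^ 2 by nra.
  nra.
- by move=> m j; case: ifP => _ //; rewrite sumR0 => [|i]; ring.
move=> z; set c := / INR n * sumR n z.
(* Parseval for the full frame is applied to the centred vector. Eigenvectors of nonzero eigenvalue
   sum to zero and do not see the centring; those of eigenvalue 0 are constant by connectedness and
   annihilate a centred vector, so dropping them changes nothing. *)
rewrite -(Hz (fun i => z i - c)); apply: eq_sumR => m; congr (_ ^ 2).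
have dev0 : sumR n (fun i => z i - c) = 0.
  by rewrite sumRB sumR_const /c; field; lra.
have -> : sumR n (fun i => e m i * (z i - c)) =
          sumR n (fun i => e m i * z i) - c * sumR n (e m).
  by rewrite -sumR_mull -sumRB; apply: eq_sumR => i; ring.
case: (boolP (good m)) => [/andP[/eqP l0 _]|].
  have : lam m * sumR n (e m) = 0.
    rewrite -sumR_mull (eq_sumR _ _ _ (fun j => esym (He m j))) exchange_sumR.
    apply: sumR0 => i; rewrite sumR_mulr.
    rewrite (eq_sumR n _ (fun j => laplacian a i j)) ?laplacian_rowsum; first by ring.
    by move=> j; apply: laplacian_sym.
  by move=> /Rmult_integral[//|->]; ring.
rewrite sumR0; last by move=> i; ring.
rewrite negb_and => /orP[/negPn/eqP l0|/existsPn e0]; last first.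
  have E i : e m i = 0 by apply/eqP; have := e0 i; rewrite negbK.
  by rewrite !sumR0 => [|i|i]; rewrite ?E; ring.
case: Hrho => v [[i0 _] _].
have C i : e m i = e m i0.
  apply: (laplacian_ker n a) => // j; rewrite He l0; ring.
rewrite -sumR_mull -sumRB (eq_sumR _ _ (fun i => e m i0 * (z i - c))).
  by rewrite sumR_mull dev0; ring.
by move=> i; rewrite C; ring.
Qed.

(** * Euclidean norm and inner product *)

Lemma norm2E p (x : vec p) : norm2 x = sumR p (fun l => x l ^ 2).
Proof. by apply: eq_sumR => l; ring. Qed.

Lemma norm2_ge0 p (x : vec p) : 0 <= norm2 x.
Proof. by rewrite norm2E; apply: sumR_ge0 => l; apply: pow2_ge_0. Qed.

Lemma norm_ge0 p (x : vec p) : 0 <= norm x.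
Proof. exact: sqrt_pos. Qed.

Lemma norm_sqr p (x : vec p) : norm x ^ 2 = norm2 x.
Proof. by rewrite /norm pow2_sqrt //; apply: norm2_ge0. Qed.

Lemma dotZr p c (x y : vec p) : dot x (vscal c y) = c * dot x y.
Proof. by rewrite -sumR_mull; apply: eq_sumR => l; rewrite /vscal; ring. Qed.

Lemma dotBl p (x y z : vec p) : dot (vsub x y) z = dot x z - dot y z.
Proof. by rewrite -sumRB; apply: eq_sumR => l; rewrite /vsub; ring. Qed.

Lemma norm2D p (x y : vec p) :
  norm2 (vadd x y) = norm2 x + 2 * dot x y + norm2 y.
Proof.
by rewrite -sumR_mull -!sumRD; apply: eq_sumR => l; rewrite /vadd; ring.
Qed.

Lemma norm2B p (x y : vec p) :
  norm2 (vsub x y) = norm2 x - 2 * dot x y + norm2 y.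
Proof.
by rewrite -sumR_mull -sumRB -sumRD; apply: eq_sumR => l; rewrite /vsub; ring.
Qed.

Lemma norm2Z p c (x : vec p) : norm2 (vscal c x) = c ^ 2 * norm2 x.
Proof. by rewrite -sumR_mull; apply: eq_sumR => l; rewrite /vscal; ring. Qed.

Lemma normZ p c (x : vec p) : norm (vscal c x) = Rabs c * norm x.
Proof.
rewrite /norm norm2Z sqrt_mult; [|exact: pow2_ge_0|exact: norm2_ge0].
by rewrite -Rsqr_pow2 sqrt_Rsqr_abs.
Qed.

Lemma norm2_vsubC p (x y : vec p) : norm2 (vsub x y) = norm2 (vsub y x).
Proof. by apply: eq_sumR => l; rewrite /vsub; ring. Qed.

Lemma cauchy_schwarz p (x y : vec p) : dot x y <= norm x * norm y.
Proof.
have H t : 0 <= norm2 x - 2 * t * dot x y + t ^ 2 * norm2 y.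
  have := norm2_ge0 p (vsub x (vscal t y)); rewrite norm2B norm2Z dotZr; lra.
rewrite -!norm_sqr in H; have := norm_ge0 p x; have := norm_ge0 p y.
set s := norm x in H *; set t := norm y in H *; set u := dot x y in H *.
move=> t0 s0; case: (Rle_lt_or_eq_dec _ _ t0) => [tp|te].
  (* With both norms positive, [s / t] makes the two square terms equal and gives the claim after
     division by [2 * s / t]. If [s = 0] the minimiser [u / t ^ 2] is used; if [t = 0] the form is
     affine and the value chosen below makes it [-1]. *)
  have := H (s / t); have -> : (s / t) ^ 2 * t ^ 2 = s ^ 2 by field; lra.
  have -> : 2 * (s / t) * u = 2 * s * u / t by field; lra.
  case: (Rle_lt_or_eq_dec _ _ s0) => [sp|se].
    move=> K; have : 2 * s * u / t <= 2 * s ^ 2 by lra.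
    move=> /(Rmult_le_compat_r t _ _ t0).
    have -> : 2 * s * u / t * t = 2 * s * u by field; lra.
    by nra.
  move: H; rewrite -se => H _.
  have := H (u / t ^ 2).
  have -> : 0 ^ 2 - 2 * (u / t ^ 2) * u + (u / t ^ 2) ^ 2 * t ^ 2 = - (u ^ 2 / t ^ 2).
    by field; lra.
  move=> K; case: (Req_dec u 0) => [->|un]; first by lra.
  have : 0 < u ^ 2 / t ^ 2 by apply: Rdiv_lt_0_compat; nra.
  by lra.
move: H; rewrite -te => H.
case: (Rle_lt_dec u 0) => [|up]; first by lra.
have := H ((s ^ 2 + 1) / (2 * u)).
have -> : 2 * ((s ^ 2 + 1) / (2 * u)) * u = s ^ 2 + 1 by field; lra.
by rewrite pow_i; [lra|lia].
Qed.

Lemma norm_triangle p (x y : vec p) : norm (vadd x y) <= norm x + norm y.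
Proof.
apply: Rsqr_incr_0_var; last by have := norm_ge0 p x; have := norm_ge0 p y; lra.
rewrite !Rsqr_pow2 norm_sqr norm2D -!norm_sqr.
have := cauchy_schwarz p x y; lra.
Qed.

Lemma Rabs_coord_le_norm p (x : vec p) l : Rabs (x l) <= norm x.
Proof.
rewrite -(Rabs_pos_eq (norm x)); last exact: norm_ge0.
apply: Rsqr_le_abs_0; rewrite !Rsqr_pow2 norm_sqr norm2E.
by apply: (sumR_term_le p (fun l => x l ^ 2)) => i; apply: pow2_ge_0.
Qed.

(** * Differentiation along lines and the descent lemma *)

Lemma is_gradient_line p (F : vec p -> R) G (y h : vec p) t :
  is_gradient F G ->
  derivable_pt_lim (fun t => F (vadd y (vscal t h))) t
    (dot (G (vadd y (vscal t h))) h).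
Proof.
move=> HG eps eps0; set x := vadd y (vscal t h).
have N0 := norm_ge0 p h.
(* The [+ 1] covers [h = 0]; the halving turns the non-strict gradient bound into the strict one
   required here. *)
have e0 : 0 < eps / 2 / (norm h + 1) by apply: Rdiv_lt_0_compat; lra.
have [dl [dl0 Hd]] := HG x _ e0.
have d0 : 0 < dl / (norm h + 1) by apply: Rdiv_lt_0_compat; lra.
exists (mkposreal _ d0) => s s0 /= Hs.
have -> : vadd y (vscal (t + s) h) = vadd x (vscal s h).
  by apply: functional_extensionality => l; rewrite /x /vadd /vscal; ring.
have As := Rabs_pos_lt s s0.
have nh : norm (vscal s h) < dl.
  rewrite normZ; have : Rabs s * (norm h + 1) < dl.
    have := Rmult_lt_compat_r (norm h + 1) _ _ _ Hs.
    have -> : dl / (norm h + 1) * (norm h + 1) = dl by field; lra.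
    by apply; lra.
  by lra.
have := Hd _ nh; rewrite dotZr normZ => K.
have -> : (F (vadd x (vscal s h)) - F x) / s - dot (G x) h =
   (F (vadd x (vscal s h)) - F x - s * dot (G x) h) / s by field.
rewrite /Rdiv Rabs_mult Rabs_inv; apply: (Rmult_lt_reg_r (Rabs s)) => //.
rewrite Rmult_assoc Rinv_l ?Rmult_1_r; last by lra.
apply: Rle_lt_trans K _.
have -> : eps / 2 / (norm h + 1) * (Rabs s * norm h) =
   (eps / 2 * Rabs s) * (norm h / (norm h + 1)) by field; lra.
have : norm h / (norm h + 1) <= 1.
  apply: (Rmult_le_reg_r (norm h + 1)); first by lra.
  by rewrite /Rdiv Rmult_assoc Rinv_l; lra.
have : 0 < eps / 2 * Rabs s by apply: Rmult_lt_0_compat; lra.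
nra.
Qed.

(** Subtracting the quadratic model before using the mean value theorem makes the derivative [f1']
    nonpositive on the unit interval. This yields the sharp constant [Lc / 2] without an
    integral. *)
Lemma descent_lemma p (F : vec p -> R) G Lc (y h : vec p) :
  is_gradient F G -> lipschitz G Lc ->
  F (vadd y h) <= F y + dot (G y) h + Lc / 2 * norm2 h.
Proof.
move=> HG HL.
pose f1 t := F (vadd y (vscal t h)) - (dot (G y) h * t + Lc / 2 * norm2 h * t ^ 2).
pose f1' t := dot (G (vadd y (vscal t h))) h
              - (dot (G y) h + Lc / 2 * norm2 h * (2 * t)).
have [c _|c [E [c0 c1]]] := MVT_cor2 f1 f1' 0 1 Rlt_0_1.
  apply: derivable_pt_lim_minus; first exact: is_gradient_line.
  apply: derivable_pt_lim_plus.
    rewrite -{2}(Rmult_1_r (dot _ _)).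
    by apply: derivable_pt_lim_scal; apply: derivable_pt_lim_id.
  apply: derivable_pt_lim_scal.
  have -> : 2 * c = INR 2 * c ^ (Nat.pred 2) by rewrite /=; ring.
  exact: derivable_pt_lim_pow.
have K : f1' c <= 0.
  rewrite /f1'.
  have := cauchy_schwarz p (vsub (G (vadd y (vscal c h))) (G y)) h.
  rewrite dotBl.
  have := HL (vadd y (vscal c h)) y.
  have -> : vsub (vadd y (vscal c h)) y = vscal c h.
    by apply: functional_extensionality => l; rewrite /vsub /vadd; ring.
  rewrite normZ Rabs_pos_eq; last by lra.
  rewrite -norm_sqr => /(Rmult_le_compat_r (norm h) _ _ (norm_ge0 p h)); lra.
move: E; rewrite /f1.
have -> : vadd y (vscal 1 h) = vadd y h.
  by apply: functional_extensionality => l; rewrite /vadd /vscal; ring.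
have -> : vadd y (vscal 0 h) = y.
  by apply: functional_extensionality => l; rewrite /vadd /vscal; ring.
lra.
Qed.

(** * Limits of descent paths and quadratic growth under the PL inequality *)

Lemma Un_cv_sumR n (u : nat -> 'I_n -> R) (v : 'I_n -> R) :
  (forall i, Un_cv (fun t => u t i) (v i)) ->
  Un_cv (fun t => sumR n (u t)) (sumR n v).
Proof.
elim: n u v => [|n IH] u v H.
  move=> e e0; exists O => t _; rewrite !sumR0 /R_dist; try by case.
  by rewrite Rminus_diag Rabs_R0.
have E (F : 'I_n.+1 -> R) :
    sumR n.+1 F = sumR n (fun i => F (widen_ord (leqnSn n) i)) + F ord_max.
  exact: big_ord_recr.
rewrite E; apply: (Un_cv_ext (fun t =>
  sumR n (fun i => u t (widen_ord (leqnSn n) i)) + u t ord_max)).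
  by move=> t; rewrite E.
by apply: CV_plus => //; apply: (IH (fun t i => u t _)).
Qed.

(** Steps bounded by the drops of a nonnegative potential have total length at most [d t] from time
    [t] on, so the path is Cauchy and its limit lies within [d t] of [x t]. *)
Lemma telescoping_limit p (x : nat -> vec p) (d : nat -> R) :
  (forall t, norm (vsub (x t.+1) (x t)) <= d t - d t.+1) ->
  (forall t, 0 <= d t) ->
  exists y, forall t, norm (vsub y (x t)) <= d t.
Proof.
move=> Hx d0.
have Hk t k : norm (vsub (x (Nat.add k t)) (x t)) <= d t - d (Nat.add k t).
  elim: k => [|k IH] /=.
    have -> : vsub (x t) (x t) = vscal 0 (x t).
      by apply: functional_extensionality => l; rewrite /vsub /vscal; ring.
    by rewrite normZ Rabs_R0; lra.
  have -> : vsub (x (Nat.add k t).+1) (x t) =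
      vadd (vsub (x (Nat.add k t).+1) (x (Nat.add k t)))
           (vsub (x (Nat.add k t)) (x t)).
    by apply: functional_extensionality => l; rewrite /vsub /vadd; ring.
  apply: Rle_trans (norm_triangle _ _ _) _.
  have := Hx (Nat.add k t); lra.
have [ld Hld] : {l | Un_cv d l}.
  apply: decreasing_cv.
    by move=> t; have := Hx t; have := norm_ge0 p (vsub (x t.+1) (x t)); lra.
  by exists 0 => _ [t ->]; rewrite /opp_seq; have := d0 t; lra.
have Cd : Cauchy_crit d by apply: CV_Cauchy; exists ld.
have Cx l : {z | Un_cv (fun t => x t l) z}.
  apply: R_complete => e e0; have [T HT] := Cd e e0.
  exists T => n m Hn Hm.
  have aux a b : le a b -> Rabs (x b l - x a l) <= d a - d b.
    move=> ab; have := Hk a (Nat.sub b a).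
    have -> : Nat.add (Nat.sub b a) a = b by lia.
    by apply: Rle_trans; apply: (Rabs_coord_le_norm p (vsub (x b) (x a))).
  have := HT n m Hn Hm; rewrite /R_dist.
  case: (Nat.le_ge_cases n m) => /aux.
    rewrite Rabs_minus_sym => K; apply: Rle_lt_trans.
    by apply: Rle_trans K _; apply: Rle_abs.
  move=> K; rewrite [Rabs (d n - _)]Rabs_minus_sym; apply: Rle_lt_trans.
  by apply: Rle_trans K _; apply: Rle_abs.
exists (fun l => proj1_sig (Cx l)) => t.
set y := fun l => _.
(* Squared norms are finite sums of squares and pass to the limit directly, without continuity of
   the square root. *)
suff H : norm2 (vsub y (x t)) <= d t ^ 2.
  apply: Rsqr_incr_0_var => //; rewrite !Rsqr_pow2 norm_sqr //.
rewrite norm2E.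
apply: (@Rle_cv_lim (fun k => sumR p (fun l => (x (Nat.add k t) l - x t l) ^ 2))
  (fun=> d t ^ 2)).
- move=> k; rewrite -(norm2E p (vsub (x (Nat.add k t)) (x t))) -norm_sqr.
  apply: pow_incr; split; first exact: norm_ge0.
  by have := Hk t k; have := d0 (Nat.add k t); lra.
- apply: (Un_cv_sumR p (fun k l => (x (Nat.add k t) l - x t l) ^ 2)) => l.
  have Cl : Un_cv (fun k => x (Nat.add k t) l - x t l) (vsub y (x t) l).
    have Hy : Un_cv (fun t => x t l) (y l) by rewrite /y; case: (Cx l).
    move=> e e0; have [T HT] := Hy e e0; exists T => k kT.
    have := HT (Nat.add k t); rewrite /R_dist /vsub.
    have -> : x (Nat.add k t) l - x t l - (y l - x t l) = x (Nat.add k t) l - y l by ring.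
    by apply; lia.
  have E (r : R) : r ^ 2 = r * r by ring.
  rewrite E; apply: (Un_cv_ext _ _ _ _ (CV_mult _ _ _ _ Cl Cl)) => k.
  by ring.
by move=> e e0; exists O => k _; rewrite /R_dist Rminus_diag Rabs_R0.
Qed.

(* [sqrt (F - fs)], suitably scaled, decreases along the iterates by at least
   the length of each step, so it bounds the length of the whole path.
   [quadratic_growth] lets [h] tend to 0. *)
Lemma gradient_descent_limit p (F : vec p -> R) G Lc nu fs h x0 :
  is_gradient F G -> lipschitz G Lc -> 0 < nu -> 0 < h -> 0 < Lc -> h * Lc < 2 ->
  (forall y, fs <= F y) -> (forall y, / 2 * norm2 (G y) >= nu * (F y - fs)) ->
  exists y, F y = fs /\
    (1 - h * Lc / 2) ^ 2 * norm2 (vsub x0 y) <= 2 / nu * (F x0 - fs).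
Proof.
move=> HG HL nu0 h0 L0 hL Hmin HPL; set c := 1 - h * Lc / 2.
have c0 : 0 < c by rewrite /c; lra.
have c1 : c < 1 by rewrite /c; have := Rmult_lt_0_compat _ _ h0 L0; lra.
pose x t := Nat.iter t (fun y => vadd y (vscal (- h) (G y))) x0.
pose q t := F (x t) - fs; pose g t := norm (G (x t)).
have q0 t : 0 <= q t by rewrite /q; have := Hmin (x t); lra.
have g0 t : 0 <= g t := norm_ge0 p _.
have PL t : 2 * nu * q t <= g t ^ 2.
  by rewrite /g norm_sqr; have := HPL (x t); rewrite /q; lra.
have hc : 0 < h * c by apply: Rmult_lt_0_compat.
have dec t : q t.+1 <= q t - h * c * g t ^ 2.
  have := descent_lemma p F G Lc (x t) (vscal (- h) (G (x t))) HG HL.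
  rewrite -[vadd _ _]/(x t.+1) dotZr norm2Z /q /g norm_sqr -/(norm2 _) /c; nra.
(* For [q t > 0], [sqrt (q t) - sqrt (q t.+1)] is at least [h * c * g t ^ 2 / (2 * sqrt (q t))] by
   descent, and PL gives [g t >= 2 * sqrt (nu / 2) * sqrt (q t)]. So the drop is at least
   [c * sqrt (nu / 2)] times the step length [h * g t]; [C] inverts this factor. *)
pose C := / (c * sqrt (nu / 2)).
have s0 : 0 < sqrt (nu / 2) by apply: sqrt_lt_R0; lra.
have cs0 : 0 < c * sqrt (nu / 2) by apply: Rmult_lt_0_compat.
have C0 : 0 < C by apply: Rinv_0_lt_compat.
have sq : sqrt (nu / 2) ^ 2 = nu / 2 by apply: pow2_sqrt; lra.
pose d t := C * sqrt (q t).
have d0 t : 0 <= d t by apply: Rmult_le_pos; [lra | apply: sqrt_pos].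
have step t : norm (vsub (x t.+1) (x t)) <= d t - d t.+1.
  have -> : vsub (x t.+1) (x t) = vscal (- h) (G (x t)).
    by apply: functional_extensionality => l; rewrite /= /vsub /vadd; ring.
  rewrite normZ Rabs_Ropp Rabs_pos_eq -/(g t); last by lra.
  have E1 := pow2_sqrt _ (q0 t); have E2 := pow2_sqrt _ (q0 t.+1).
  have S1 := sqrt_pos (q t); have S2 := sqrt_pos (q t.+1).
  have D := dec t; have P := PL t; have G0 := g0 t.
  rewrite /d -Rmult_minus_distr_l; apply: (Rmult_le_reg_l (c * sqrt (nu / 2))) => //.
  rewrite -(Rmult_assoc _ C) /C Rinv_r ?Rmult_1_l; last by lra.
  rewrite -E1 -E2 in D; rewrite -E1 in P.
  move: (sqrt (q t)) (sqrt (q t.+1)) (g t) (sqrt (nu / 2)) sq s0 S1 S2 D P G0.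
  move=> a b u s Es s0 a0 b0 D P u0 {E1 E2}.
  have nuE : nu = 2 * s ^ 2 by lra.
  have su : 2 * s * a <= u.
    apply: Rsqr_incr_0_var => //; rewrite !Rsqr_pow2; rewrite nuE in P; lra.
  have ba : b <= a.
    apply: Rsqr_incr_0_var => //; rewrite !Rsqr_pow2.
    have : 0 <= h * c * u ^ 2 by apply: Rmult_le_pos; [lra | apply: pow2_ge_0].
    by lra.
  (* If [a = 0] the iterate is already a minimiser and one cannot divide by [a]; descent then forces
     the gradient, hence the step, to vanish. *)
  case: (Rle_lt_or_eq_dec _ _ a0) => [ap|ae].
    have K : 2 * a * (c * s * (h * u)) <= 2 * a * (a - b).
      have : h * c * (2 * s * a * u) <= h * c * u ^ 2.
        apply: Rmult_le_compat_l; first by lra.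
        by have := Rmult_le_compat_r u _ _ u0 su; lra.
      have : (a - b) * (a - b) >= 0 by nra.
      by nra.
    by apply: (Rmult_le_reg_l (2 * a)) => //; lra.
  have b00 : b = 0 by lra.
  have : h * c * u ^ 2 <= 0 by move: D; rewrite -ae b00; lra.
  move=> K; have u2 : u ^ 2 <= 0.
    by apply: (Rmult_le_reg_l (h * c)) => //; lra.
  have u00 : u = 0 by nra.
  by rewrite u00 -ae b00; lra.
have [y Hy] := telescoping_limit p x d step d0.
have dsq t : d t ^ 2 = C ^ 2 * q t.
  by rewrite /d Rpow_mult_distr pow2_sqrt.
have C2 : C ^ 2 * c ^ 2 = 2 / nu.
  rewrite /C Rinv_mult Rpow_mult_distr !pow_inv sq; field; lra.
have bound t : norm2 (vsub y (x t)) <= C ^ 2 * q t.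
  rewrite -norm_sqr -dsq; apply: pow_incr; split=> //; exact: norm_ge0.
exists y; split; last first.
  rewrite norm2_vsubC -C2; have := bound O; rewrite /q /=.
  move=> /(Rmult_le_compat_l (c ^ 2) _ _ (pow2_ge_0 _)).
  lra.
(* Replaces continuity of [F] at the limit: the descent lemma from [x t] to [y], with AM-GM on the
   inner product, bounds the excess at [y] by a fixed multiple of every [q t]. *)
pose B := 1 + (/ (h * c) + C ^ 2) / 2 + Lc / 2 * C ^ 2.
have FyB t : F y - fs <= B * q t.
  have := descent_lemma p F G Lc (x t) (vsub y (x t)) HG HL.
  have -> : vadd (x t) (vsub y (x t)) = y.
    by apply: functional_extensionality => l; rewrite /vsub /vadd; ring.
  have CS := cauchy_schwarz p (G (x t)) (vsub y (x t)).
  have := bound t => bt.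
  have AG : norm (G (x t)) * norm (vsub y (x t)) <= (g t ^ 2 + norm2 (vsub y (x t))) / 2.
    by rewrite -norm_sqr -/(g t); have := pow2_ge_0 (g t - norm (vsub y (x t))); lra.
  have gq : g t ^ 2 <= / (h * c) * q t.
    apply: (Rmult_le_reg_l (h * c)) => //; rewrite -Rmult_assoc Rinv_r; last by lra.
    by have := dec t; have := q0 t.+1; lra.
  have L2 : 0 <= Lc / 2 by lra.
  have := Rmult_le_compat_l (Lc / 2) _ _ L2 bt.
  rewrite /B /q in bt gq *; lra.
pose k := 2 * nu * (h * c).
have k0 : 0 < k by apply: Rmult_lt_0_compat; lra.
(* The geometric decay is weakened to a rate of order [1 / t], which already suffices for the
   Archimedean contradiction below. *)
have decay t : (1 + INR t * k) * q t <= q O.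
  elim: t => [|t IH]; first by rewrite /=; lra.
  have qk : q t.+1 <= q t - k * q t.
    have := dec t; have := Rmult_le_compat_l (h * c) _ _ (Rlt_le _ _ hc) (PL t).
    by rewrite /k; lra.
  have qm : q t.+1 <= q t.
    by have := Rmult_le_pos k (q t) (Rlt_le _ _ k0) (q0 t); lra.
  rewrite S_INR; have := q0 t; have := q0 t.+1; have := pos_INR t.
  move: (INR t) (q t) (q t.+1) IH qk qm => T a b IH ba1 ba2 T0 b0 a0.
  have : T * k * b <= T * k * a by apply: Rmult_le_compat_l => //; apply: Rmult_le_pos; lra.
  have : k * b <= k * a by apply: Rmult_le_compat_l => //; lra.
  lra.
have B0 : 0 < B.
  have : 0 < / (h * c) by apply: Rinv_0_lt_compat.
  have : 0 <= C ^ 2 by apply: pow2_ge_0.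
  rewrite /B => C20; have : 0 <= Lc / 2 * C ^ 2 by apply: Rmult_le_pos; lra.
  by lra.
case: (Rle_lt_dec (F y) fs) => [|Fy]; first by have := Hmin y; lra.
exfalso; have f0 : 0 < F y - fs by lra.
have Bq : 0 <= B * q O by apply: Rmult_le_pos => //; lra.
have [T HT] := INR_unbounded (B * q O / (k * (F y - fs))).
have kf : 0 < k * (F y - fs) by apply: Rmult_lt_0_compat.
have : B * q O < INR T * (k * (F y - fs)).
  have := Rmult_lt_compat_r _ _ _ kf HT.
  by rewrite /Rdiv Rmult_assoc Rinv_l; lra.
have := decay T; have := FyB T; have := pos_INR T.
move: (INR T) (q T) (q O) => t a b t0 H1 H2 H3.
have tk : 0 <= t * k by apply: Rmult_le_pos; lra.
have := Rmult_le_compat_l B _ _ (Rlt_le _ _ B0) H2.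
have tk1 : 0 <= 1 + t * k by lra.
have := Rmult_le_compat_l (1 + t * k) _ _ tk1 H1.
nra.
Qed.

(** [d] is any lower bound on the squared distance from [x] to the minimisers, so no nearest point
    has to exist for this statement. *)
Lemma quadratic_growth p (F : vec p -> R) G Lc nu fs x d :
  is_gradient F G -> lipschitz G Lc -> 0 < nu -> 0 < Lc ->
  (forall y, fs <= F y) -> (forall y, / 2 * norm2 (G y) >= nu * (F y - fs)) ->
  (forall y, F y = fs -> d <= norm2 (vsub x y)) ->
  d <= 2 / nu * (F x - fs).
Proof.
move=> HG HL nu0 L0 Hmin HPL Hd; set D := 2 / nu * (F x - fs).
have D0 : 0 <= D.
  apply: Rmult_le_pos; last by have := Hmin x; lra.
  by apply: Rlt_le; apply: Rdiv_lt_0_compat; lra.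
case: (Rle_lt_dec d D) => // dD; exfalso.
have dL : 0 < 2 * d * Lc by apply: Rmult_lt_0_compat; lra.
(* Chosen so that [(1 - h * Lc) * d = (d + D) / 2], which exceeds [D], while
   [1 - h * Lc <= (1 - h * Lc / 2) ^ 2]. *)
pose h := (d - D) / (2 * d * Lc).
have h0 : 0 < h by apply: Rdiv_lt_0_compat; lra.
have E : h * Lc * (2 * d) = d - D by rewrite /h; field; lra.
have hL : h * Lc < 2.
  apply: (Rmult_lt_reg_r (2 * d)); lra.
have [y [Fy]] := gradient_descent_limit p F G Lc nu fs h x HG HL nu0 h0 L0 hL Hmin HPL.
rewrite -/D => K.
have := Rmult_le_compat_l _ _ _ (pow2_ge_0 (1 - h * Lc / 2)) (Hd y Fy).
have := pow2_ge_0 (h * Lc / 2); nra.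
Qed.

(** * Scalar estimates for a single mode *)

(** Given the other two terms, [/ lam + alpha / beta] is the weight of [w ^ 2 / 2] for which the
    [x * w] terms cancel in the first-order change along the iteration. *)
Definition modeV alpha beta lam x w :=
  x ^ 2 / 2 + (/ lam + alpha / beta) / 2 * w ^ 2 + x * w.

Lemma modeV_lower rho rho2 alpha beta lam x w :
  0 < rho2 -> rho2 <= lam <= rho -> 0 < beta -> beta < alpha ->
  epsc9 rho alpha beta * (x ^ 2 + w ^ 2) <= modeV alpha beta lam x w.
Proof.
move=> r0 [l1 l2] b0 ab.
(* Completing the square consumes the cross term and the whole [alpha / beta] weight; the two
   coefficients left over are the ones compared in [epsc9]. *)
have E : modeV alpha beta lam x w = (alpha - beta) / (2 * alpha) * x ^ 2
    + / (2 * lam) * w ^ 2 + (beta * x + alpha * w) ^ 2 / (2 * alpha * beta).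
  rewrite /modeV; field; lra.
have S : 0 <= (beta * x + alpha * w) ^ 2 / (2 * alpha * beta).
  apply: Rle_mult_inv_pos; first exact: pow2_ge_0.
  by apply: Rmult_lt_0_compat; lra.
have ir : / (2 * rho) <= / (2 * lam) by apply: Rinv_le_contravar; lra.
rewrite E /epsc9 Rmult_plus_distr_l.
have := Rmult_le_compat_r (x ^ 2) _ _ (pow2_ge_0 _)
  (Rmin_r (/ (2 * rho)) ((alpha - beta) / (2 * alpha))).
have := Rmult_le_compat_r (w ^ 2) _ _ (pow2_ge_0 _)
  (Rle_trans _ _ _ (Rmin_l (/ (2 * rho)) ((alpha - beta) / (2 * alpha))) ir).
lra.
Qed.

Lemma modeV_upper rho2 alpha beta lam x w :
  0 < rho2 -> rho2 <= lam -> 0 < beta -> beta < alpha ->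
  modeV alpha beta lam x w <= epsc8 rho2 alpha beta * (x ^ 2 + w ^ 2).
Proof.
move=> r0 l1 b0 ab.
have il : / lam <= / rho2 by apply: Rinv_le_contravar.
have i2 : 0 < / rho2 by apply: Rinv_0_lt_compat.
have k0 : 1 < alpha / beta.
  by apply: (Rmult_lt_reg_r beta) => //; rewrite /Rdiv Rmult_assoc Rinv_l; lra.
have -> : epsc8 rho2 alpha beta = (alpha / beta + 1 + / rho2) / 2.
  rewrite /epsc8; field; lra.
have := Rmult_le_compat_r (w ^ 2) _ _ (pow2_ge_0 _) il.
have := Rmult_le_pos _ (x ^ 2) (Rlt_le _ _ i2) (pow2_ge_0 _).
have := Rmult_le_compat_r (x ^ 2) _ _ (pow2_ge_0 _) (Rlt_le _ _ k0).
have := pow2_ge_0 (x - w).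
rewrite /modeV; lra.
Qed.

(* Here [d] is the disagreement of the gradients, [dl] the scaled increment of
   the averaged gradients, and [lam] stands for the Laplacian. *)
Lemma modeV_step rho rho2 alpha beta eta lam x w d dl :
  0 < rho2 -> rho2 <= lam <= rho -> 0 < beta -> beta < alpha -> 0 < eta ->
  modeV alpha beta lam (x - eta * (alpha * lam * x + beta * w + d))
                       (w + eta * (beta * lam * x + dl))
  <= modeV alpha beta lam x w
     - eta * (((alpha - beta) * rho2 - 1) * x ^ 2 - d ^ 2
              + epsc3 rho2 alpha beta * w ^ 2
              - beta / 2 * (/ beta + / rho2 + alpha / beta) * dl ^ 2)
     + eta ^ 2 * ((beta ^ 2 * rho + (2 * alpha ^ 2 + beta ^ 2) * rho ^ 2) * x ^ 2
                  + 2 * d ^ 2 + epsc4 beta * w ^ 2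
                  + (/ rho2 + alpha / beta + 2) * dl ^ 2).
Proof.
move=> r0 [l1 l2] b0 ab e0.
have il : / lam <= / rho2 by apply: Rinv_le_contravar.
have i0 : 0 < / lam by apply: Rinv_0_lt_compat; lra.
set k := alpha / beta.
have k1 : 1 < k.
  by apply: (Rmult_lt_reg_r beta) => //; rewrite /k /Rdiv Rmult_assoc Rinv_l; lra.
set y := beta * lam * x + dl.
pose first := - (alpha - beta) * lam * x ^ 2 - beta * w ^ 2 - (x + w) * d
              + x * dl + (/ lam + k) * w * dl.
pose second := (alpha * lam * x + beta * w + d) ^ 2 / 2 + (/ lam + k) / 2 * y ^ 2
               - (alpha * lam * x + beta * w + d) * y.
have -> : modeV alpha beta lam (x - eta * (alpha * lam * x + beta * w + d)) (w + eta * y)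
    = modeV alpha beta lam x w + eta * first + eta ^ 2 * second.
  rewrite /modeV /first /second /y /k; field; lra.
have H1 : first <= - (((alpha - beta) * rho2 - 1) * x ^ 2 - d ^ 2
              + epsc3 rho2 alpha beta * w ^ 2
              - beta / 2 * (/ beta + / rho2 + k) * dl ^ 2).
  have -> : epsc3 rho2 alpha beta = beta - / 2 - k / (2 * beta) - / rho2 / (2 * beta).
    rewrite /epsc3 /k; field; lra.
  (* Young's inequality with weight [beta], so that the [w ^ 2] losses are exactly those subtracted
     from [beta] in [epsc3]. *)
  have AG : w * dl <= w ^ 2 / (2 * beta) + beta / 2 * dl ^ 2.
    have : 0 <= (w - beta * dl) ^ 2 / (2 * beta).
      by apply: Rle_mult_inv_pos; [exact: pow2_ge_0 | lra].
    have -> : (w - beta * dl) ^ 2 / (2 * beta) =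
        w ^ 2 / (2 * beta) + beta / 2 * dl ^ 2 - w * dl by field; lra.
    by lra.
  have := Rmult_le_compat_l k _ _ ltac:(lra) AG.
  have := Rmult_le_compat_l (/ lam) _ _ (Rlt_le _ _ i0) AG.
  have AG0 : 0 <= w ^ 2 / (2 * beta) + beta / 2 * dl ^ 2.
    apply: Rplus_le_le_0_compat.
      by apply: Rle_mult_inv_pos; [exact: pow2_ge_0 | lra].
    by apply: Rmult_le_pos; [lra | exact: pow2_ge_0].
  have := Rmult_le_compat_r _ _ _ AG0 il.
  have := Rmult_le_compat_l (alpha - beta) _ _ ltac:(lra)
    (Rmult_le_compat_r (x ^ 2) _ _ (pow2_ge_0 x) l1).
  have := pow2_ge_0 (x + d); have := pow2_ge_0 (w + d); have := pow2_ge_0 (x - dl).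
  have -> : beta / 2 * (/ beta + / rho2 + k) * dl ^ 2 =
     dl ^ 2 / 2 + (/ rho2 + k) * (beta / 2 * dl ^ 2) by field; lra.
  rewrite /first /Rdiv; lra.
have H2 : second <= (beta ^ 2 * rho + (2 * alpha ^ 2 + beta ^ 2) * rho ^ 2) * x ^ 2
                  + 2 * d ^ 2 + epsc4 beta * w ^ 2
                  + (/ rho2 + k + 2) * dl ^ 2.
  have Y : (/ lam + k) / 2 * y ^ 2 <=
      beta ^ 2 * lam * x ^ 2 + alpha * beta * lam ^ 2 * x ^ 2 + (/ rho2 + k) * dl ^ 2.
    have : y ^ 2 / 2 <= (beta * lam * x) ^ 2 + dl ^ 2.
      by have := pow2_ge_0 (beta * lam * x - dl); rewrite /y; lra.
    move=> /(Rmult_le_compat_l (/ lam + k) _ _ ltac:(lra)).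
    have := Rmult_le_compat_r (dl ^ 2) _ _ (pow2_ge_0 _) il.
    have -> : (/ lam + k) * ((beta * lam * x) ^ 2 + dl ^ 2) =
      beta ^ 2 * lam * x ^ 2 + alpha * beta * lam ^ 2 * x ^ 2 + (/ lam + k) * dl ^ 2.
      rewrite /k; field; lra.
    by lra.
  have U : (alpha * lam * x + beta * w + d) ^ 2 / 2 - (alpha * lam * x + beta * w + d) * y
      <= 2 * (alpha - beta) ^ 2 * lam ^ 2 * x ^ 2 + 2 * beta ^ 2 * w ^ 2
         + 2 * d ^ 2 + 2 * dl ^ 2.
    (* Completing the square against [y] replaces [alpha] by [alpha - beta] before the four terms
       are separated, and leaves a negative [y ^ 2 / 2] to drop. The smaller coefficient is what
       lets [A] below reach the constant of [epsc2]. *)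
    have -> : (alpha * lam * x + beta * w + d) ^ 2 / 2
        - (alpha * lam * x + beta * w + d) * y =
        ((alpha - beta) * lam * x + beta * w + d - dl) ^ 2 / 2 - y ^ 2 / 2.
      rewrite /y; field.
    have S4 p1 p2 p3 p4 : (p1 + p2 + p3 - p4) ^ 2 / 2 <=
        2 * p1 ^ 2 + 2 * p2 ^ 2 + 2 * p3 ^ 2 + 2 * p4 ^ 2.
      have := pow2_ge_0 (p1 - p2); have := pow2_ge_0 (p1 - p3).
      have := pow2_ge_0 (p1 + p4); have := pow2_ge_0 (p2 - p3).
      have := pow2_ge_0 (p2 + p4); have := pow2_ge_0 (p3 + p4); lra.
    have := S4 ((alpha - beta) * lam * x) (beta * w) d dl.
    by have := pow2_ge_0 y; lra.
  have A : 2 * (alpha - beta) ^ 2 + alpha * beta <= 2 * alpha ^ 2 + beta ^ 2.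
    have : 0 <= beta * (3 * alpha - beta) by apply: Rmult_le_pos; lra.
    by lra.
  have x2 := pow2_ge_0 x; have w2 := pow2_ge_0 w; have b2 := pow2_ge_0 beta.
  have L2 : lam ^ 2 <= rho ^ 2 by apply: pow_incr; lra.
  have lx : 0 <= lam ^ 2 * x ^ 2 by apply: Rmult_le_pos => //; apply: pow2_ge_0.
  have := Rmult_le_compat_r _ _ _ lx A.
  have P0 : 0 <= 2 * alpha ^ 2 + beta ^ 2 by have := pow2_ge_0 alpha; lra.
  have := Rmult_le_compat_l _ _ _ P0 (Rmult_le_compat_r _ _ _ x2 L2).
  have := Rmult_le_compat_l _ _ _ b2 (Rmult_le_compat_r _ _ _ x2 l2).
  rewrite /second /epsc4; lra.
have := Rmult_le_compat_l eta _ _ (Rlt_le _ _ e0) H1.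
have := Rmult_le_compat_l (eta ^ 2) _ _ (pow2_ge_0 eta) H2.
lra.
Qed.

(** * Disagreement of stacked vectors and the lifting of the scalar estimates *)

Definition dev2 {n p} (z : svec n p) : R :=
  snorm2 (fun i => vsub (z i) (avg z)).

Lemma snorm2_ge0 n p (z : svec n p) : 0 <= snorm2 z.
Proof. by apply: sumR_ge0 => i; apply: norm2_ge0. Qed.

Lemma dev2E n p (z : svec n p) : 0 < INR n ->
  dev2 z = snorm2 z - INR n * norm2 (avg z).
Proof.
move=> n0; rewrite /dev2 /snorm2.
rewrite (eq_sumR _ _ (fun i => sumR p (fun l => (z i l - avg z l) ^ 2))); last first.
  by move=> i; rewrite norm2E.
rewrite exchange_sumR (eq_sumR _ _ _ (fun l => sumR_sqr_dev n (z^~ l) n0)) sumRB.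
rewrite exchange_sumR; congr (_ - _).
  by apply: eq_sumR => i; rewrite norm2E.
rewrite norm2E -sumR_mull; apply: eq_sumR => l; rewrite /avg; field; lra.
Qed.

Lemma avg_norm2_le n p (z : svec n p) : 0 < INR n ->
  INR n * norm2 (avg z) <= snorm2 z.
Proof.
move=> n0; have := snorm2_ge0 n p (fun i => vsub (z i) (avg z)).
by rewrite -/(dev2 z) dev2E //; lra.
Qed.

Lemma KformE n p (z : svec n p) : 0 < INR n -> Kform z = dev2 z.
Proof.
move=> n0; rewrite dev2E //.
have E i : sumR n (fun j => ((if i == j then 1 else 0) - / INR n) * dot (z i) (z j))
    = norm2 (z i) - / INR n * sumR n (fun j => dot (z i) (z j)).
  rewrite -sumR_mull /norm2 -(sumR_delta n (fun j => dot (z i) (z j)) i) -sumRB.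
  by apply: eq_sumR => j; ring.
rewrite /Kform (eq_sumR _ _ _ E) sumRB; congr (_ - _).
rewrite (eq_sumR _ _ (fun i => / INR n * sumR p (fun l => z i l * sumR n (z^~ l)))).
  rewrite sumR_mull exchange_sumR norm2E -!sumR_mull; apply: eq_sumR => l.
  rewrite sumR_mulr /avg; field; lra.
move=> i; congr (_ * _); rewrite exchange_sumR; apply: eq_sumR => l; exact: sumR_mull.
Qed.

Definition coord {N n p} (e : 'I_N -> 'I_n -> R) (z : svec n p) m l :=
  sumR n (fun i => e m i * z i l).

(** For the Laplacian eigenframe, [/ lam] represents the pseudoinverse of the Laplacian, and this is
    half the squared K-seminorm of [x], plus half the form of that pseudoinverse plus [alpha / beta]
    times K at [w], plus the K-product of [x] and [w]. *)
Definition consensusV {N n p} alpha beta (e : 'I_N -> 'I_n -> R) lam (x w : svec n p) :=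
  sumR N (fun m => sumR p (fun l =>
    modeV alpha beta (lam m) (coord e x m l) (coord e w m l))).

Section ConsensusPart.
Variables (N n p : nat) (a : 'I_n -> 'I_n -> R) (rho rho2 alpha beta eta : R).
Variables (e : 'I_N -> 'I_n -> R) (lam : 'I_N -> R).
Hypotheses (Ha : undirected_weighted a) (n0 : 0 < INR n).
Hypothesis Hlam : forall m, rho2 <= lam m <= rho.
Hypothesis He :
  forall m j, sumR n (fun i => laplacian a j i * e m i) = lam m * e m j.
Hypothesis Hz : forall z : 'I_n -> R,
  sumR N (fun m => sumR n (fun i => e m i * z i) ^ 2) =
  sumR n (fun i => (z i - / INR n * sumR n z) ^ 2).
Hypotheses (r0 : 0 < rho2) (b0 : 0 < beta) (ab : beta < alpha).

Let sum2 (F : 'I_N -> 'I_p -> R) := sumR N (fun m => sumR p (fun l => F m l)).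

Let sum2D F G : sum2 (fun m l => F m l + G m l) = sum2 F + sum2 G.
Proof. by rewrite -sumRD; apply: eq_sumR => m; rewrite sumRD. Qed.

Let sum2_mull c F : sum2 (fun m l => c * F m l) = c * sum2 F.
Proof. by rewrite -sumR_mull; apply: eq_sumR => m; rewrite sumR_mull. Qed.

Let sum2_le F G : (forall m l, F m l <= G m l) -> sum2 F <= sum2 G.
Proof. by move=> H; apply: sumR_le => m; apply: sumR_le. Qed.

Let sum2_coord (z : svec n p) : sum2 (fun m l => coord e z m l ^ 2) = dev2 z.
Proof.
rewrite /sum2 exchange_sumR (eq_sumR _ _ _ (fun l => Hz (z^~ l))) exchange_sumR.
by apply: eq_sumR => i; rewrite norm2E.
Qed.

Lemma consensusV_lower (x w : svec n p) :
  epsc9 rho alpha beta * (dev2 x + dev2 w) <= consensusV alpha beta e lam x w.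
Proof.
rewrite -!sum2_coord -sum2D -sum2_mull; apply: sum2_le => m l.
exact: (modeV_lower rho rho2).
Qed.

Lemma consensusV_upper (x w : svec n p) :
  consensusV alpha beta e lam x w <= epsc8 rho2 alpha beta * (dev2 x + dev2 w).
Proof.
rewrite -!sum2_coord -sum2D -sum2_mull; apply: sum2_le => m l.
by apply: modeV_upper => //; case: (Hlam m).
Qed.

Lemma consensusV_step (x w d dl x' w' : svec n p) :
  0 < eta ->
  (forall i l, x' i l = x i l - eta *
     (alpha * sumR n (fun j => laplacian a i j * x j l) + beta * w i l + d i l)) ->
  (forall i l, w' i l = w i l + eta *
     (beta * sumR n (fun j => laplacian a i j * x j l) + dl i l)) ->
  consensusV alpha beta e lam x' w' <= consensusV alpha beta e lam x w
     - eta * (((alpha - beta) * rho2 - 1) * dev2 x - dev2 d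
              + epsc3 rho2 alpha beta * dev2 w
              - beta / 2 * (/ beta + / rho2 + alpha / beta) * dev2 dl)
     + eta ^ 2 * ((beta ^ 2 * rho + (2 * alpha ^ 2 + beta ^ 2) * rho ^ 2) * dev2 x
                  + 2 * dev2 d + epsc4 beta * dev2 w
                  + (/ rho2 + alpha / beta + 2) * dev2 dl).
Proof.
move=> e0 Hx' Hw'.
have cL m l : sumR n (fun i => e m i * sumR n (fun j => laplacian a i j * x j l))
    = lam m * coord e x m l.
  rewrite -sumR_mull (eq_sumR _ _ (fun i => sumR n (fun j => laplacian a j i * e m i * x j l))).
    rewrite exchange_sumR; apply: eq_sumR => j.
    by rewrite sumR_mulr He; ring.
  by move=> i; rewrite -sumR_mull; apply: eq_sumR => j; rewrite (laplacian_sym n a Ha i j); ring.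
have cx m l : coord e x' m l = coord e x m l - eta *
    (alpha * lam m * coord e x m l + beta * coord e w m l + coord e d m l).
  rewrite Rmult_assoc -cL /coord -!sumR_mull -!sumRD -sumR_mull -sumRB.
  by apply: eq_sumR => i; rewrite Hx'; ring.
have cw m l : coord e w' m l = coord e w m l + eta *
    (beta * lam m * coord e x m l + coord e dl m l).
  rewrite Rmult_assoc -cL /coord -!sumR_mull -!sumRD -sumR_mull -sumRD.
  by apply: eq_sumR => i; rewrite Hw'; ring.
set A := (alpha - beta) * rho2 - 1; set B := beta / 2 * _; set C := _ + _ * rho ^ 2.
set D := / rho2 + _ + 2.
(* Regrouped so that each squared coordinate carries a single constant; [sum2_coord] then turns
   every sum into a [dev2]. *)
apply: (Rle_trans _ (sum2 (fun m l =>
    modeV alpha beta (lam m) (coord e x m l) (coord e w m l)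
    + ((- eta * A + eta ^ 2 * C) * coord e x m l ^ 2
    + ((eta + eta ^ 2 * 2) * coord e d m l ^ 2
    + ((- eta * epsc3 rho2 alpha beta + eta ^ 2 * epsc4 beta) * coord e w m l ^ 2
    + (eta * B + eta ^ 2 * D) * coord e dl m l ^ 2)))))).
  apply: sum2_le => m l; rewrite cx cw.
  have := modeV_step rho rho2 alpha beta eta (lam m) (coord e x m l) (coord e w m l)
    (coord e d m l) (coord e dl m l) r0 (Hlam m) b0 ab e0.
  rewrite -/A -/B -/C -/D; lra.
rewrite (sum2D (fun m l => modeV alpha beta (lam m) (coord e x m l) (coord e w m l))).
rewrite -[sum2 (fun m l => modeV _ _ _ _ _)]/(consensusV alpha beta e lam x w).
by rewrite !sum2D !sum2_mull !sum2_coord; lra.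
Qed.
End ConsensusPart.

(** * Gradient and Lipschitz constant of the average objective *)

Lemma is_gradient_sum n p (f : 'I_n -> vec p -> R) (G : 'I_n -> vec p -> vec p) :
  (forall i, is_gradient (f i) (G i)) ->
  is_gradient (fun y => sumR n (fun i => f i y)) (fun y l => sumR n (fun i => G i y l)).
Proof.
elim: n f G => [|n IH] f G H x eps eps0.
  exists 1; split; [lra | move=> h _].
  rewrite !sumR0; try by case.
  rewrite /dot sumR0 => [|l]; last by rewrite sumR0; [ring | case].
  by rewrite !Rminus_0_r Rabs_R0; apply: Rmult_le_pos; [lra | apply: norm_ge0].
have e2 : 0 < eps / 2 by lra.
have E (F : 'I_n.+1 -> R) :
    sumR n.+1 F = sumR n (fun i => F (widen_ord (leqnSn n) i)) + F ord_max.
  exact: big_ord_recr.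
have [d1 [d10 H1]] := IH (fun i => f (widen_ord (leqnSn n) i)) (fun i => G (widen_ord (leqnSn n) i))
  (fun i => H _) x _ e2.
have [d2 [d20 H2]] := H ord_max x _ e2.
exists (Rmin d1 d2); split; first exact: Rmin_pos.
move=> h Hh.
have := H1 h (Rlt_le_trans _ _ _ Hh (Rmin_l _ _)).
have := H2 h (Rlt_le_trans _ _ _ Hh (Rmin_r _ _)).
rewrite !E.
have -> : dot (fun l => sumR n.+1 (fun i => G i x l)) h =
    dot (fun l => sumR n (fun i => G (widen_ord (leqnSn n) i) x l)) h + dot (G ord_max x) h.
  by rewrite -sumRD; apply: eq_sumR => l; rewrite E; ring.
set r1 := (X in Rabs X <= _ -> _); set r2 := (X in _ -> Rabs X <= _ -> _).
move=> K1 K2; have := Rabs_triang r1 r2.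
set r := (X in _ -> Rabs X <= _).
have -> : r = r1 + r2 by rewrite /r /r1 /r2; ring.
lra.
Qed.

Lemma is_gradient_scal p c (f : vec p -> R) G :
  is_gradient f G -> is_gradient (fun y => c * f y) (fun y => vscal c (G y)).
Proof.
move=> H x eps eps0; have C0 := Rabs_pos c.
have e0 : 0 < eps / (Rabs c + 1) by apply: Rdiv_lt_0_compat; lra.
have [d [d0 Hd]] := H x _ e0; exists d; split=> // h /Hd K.
have -> : c * f (vadd x h) - c * f x - dot (vscal c (G x)) h =
    c * (f (vadd x h) - f x - dot (G x) h).
  have -> : dot (vscal c (G x)) h = c * dot (G x) h.
    by rewrite -sumR_mull; apply: eq_sumR => l; rewrite /vscal; ring.
  by ring.
rewrite Rabs_mult; have N0 := norm_ge0 p h.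
apply: (Rle_trans _ _ _ (Rmult_le_compat_l _ _ _ C0 K)).
have -> : Rabs c * (eps / (Rabs c + 1) * norm h) =
   eps * norm h * (Rabs c / (Rabs c + 1)) by field; lra.
have : Rabs c / (Rabs c + 1) <= 1.
  by apply: (Rmult_le_reg_r (Rabs c + 1)); rewrite ?/Rdiv ?Rmult_assoc ?Rinv_l; lra.
have : 0 <= eps * norm h by apply: Rmult_le_pos; lra.
by move=> P Q; have := Rmult_le_compat_l _ _ _ P Q; lra.
Qed.

Lemma is_gradient_avg n p (f : 'I_n -> vec p -> R) (G : 'I_n -> vec p -> vec p) :
  (forall i, is_gradient (f i) (G i)) ->
  is_gradient (fun y => / INR n * sumR n (fun i => f i y)) (fun y => avg (fun i => G i y)).
Proof. by move=> H; apply: is_gradient_scal; apply: is_gradient_sum. Qed.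

Lemma lipschitz_norm2 p (G : vec p -> vec p) Lc x y : lipschitz G Lc ->
  norm2 (vsub (G x) (G y)) <= Lc ^ 2 * norm2 (vsub x y).
Proof.
move=> H; rewrite -!norm_sqr -Rpow_mult_distr; apply: pow_incr.
by split; [apply: norm_ge0 | apply: H].
Qed.

(** By Jensen's inequality, in the form [avg_norm2_le], averaging does not enlarge the constant. *)
Lemma lipschitz_avg n p (G : 'I_n -> vec p -> vec p) Lc : 0 < INR n -> 0 <= Lc ->
  (forall i, lipschitz (G i) Lc) -> lipschitz (fun y => avg (fun i => G i y)) Lc.
Proof.
move=> n0 L0 H x y; set z : svec n p := fun i => vsub (G i x) (G i y).
have -> : vsub (avg (fun i => G i x)) (avg (fun i => G i y)) = avg z.
  by apply: functional_extensionality => l; rewrite /vsub /avg sumRB; ring.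
apply: Rsqr_incr_0_var; last by apply: Rmult_le_pos => //; apply: norm_ge0.
rewrite !Rsqr_pow2 Rpow_mult_distr !norm_sqr; apply: (Rmult_le_reg_l (INR n)) => //.
apply: (Rle_trans _ _ _ (avg_norm2_le n p z n0)).
rewrite -sumR_const; apply: sumR_le => i; exact: lipschitz_norm2.
Qed.

(** * Step-size margins and inequalities between the constants *)

Lemma kappac1_gt0 Lf rho2 : 0 < rho2 -> 0 < kappac1 Lf rho2.
Proof.
by move=> r0; apply: Rdiv_lt_0_compat; have := pow2_ge_0 Lf; lra.
Qed.

Lemma kappac3_gt0 rho2 kappa2 : 0 < kappac3 rho2 kappa2.
Proof. by have := sqrt_pos (1 + 8 * kappa2 + 8 / rho2); rewrite /kappac3; lra. Qed.

Lemma Rlt_div_minus_gt0 x y z : 0 < z -> x < y / z -> 0 < y - x * z.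
Proof.
by move=> z0 /(Rmult_lt_compat_r z _ _ z0); rewrite /Rdiv Rmult_assoc Rinv_l; lra.
Qed.

Lemma eps1_margin Lf rho rho2 alpha beta eta :
  0 < rho -> 0 < beta -> eta < epsc1 Lf rho2 alpha beta / epsc2 Lf rho alpha beta ->
  0 < epsc1 Lf rho2 alpha beta - eta * epsc2 Lf rho alpha beta.
Proof.
move=> r0 b0; apply: Rlt_div_minus_gt0.
have : 0 < beta ^ 2 * rho by apply: Rmult_lt_0_compat => //; apply: pow_lt.
have : 0 <= (2 * alpha ^ 2 + beta ^ 2) * rho ^ 2.
  apply: Rmult_le_pos; last exact: pow2_ge_0.
  by have := pow2_ge_0 alpha; have := pow2_ge_0 beta; lra.
by have := pow2_ge_0 Lf; rewrite /epsc2; lra.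
Qed.

Lemma eps3_margin rho2 alpha beta eta :
  eta < epsc3 rho2 alpha beta / epsc4 beta ->
  0 < epsc3 rho2 alpha beta - eta * epsc4 beta.
Proof.
by apply: Rlt_div_minus_gt0; have := pow2_ge_0 beta; rewrite /epsc4; lra.
Qed.

Lemma eps5_margin Lf rho2 alpha beta eta :
  0 < Lf -> 0 < rho2 -> 0 < beta -> 0 < alpha ->
  eta < epsc5 Lf rho2 alpha beta / epsc6 Lf rho2 alpha beta ->
  0 < epsc5 Lf rho2 alpha beta - eta * epsc6 Lf rho2 alpha beta.
Proof.
move=> L0 r0 b0 a0; apply: Rlt_div_minus_gt0.
have i2 : 0 < / rho2 by apply: Rinv_0_lt_compat.
have k0 : 0 < alpha / beta by apply: Rdiv_lt_0_compat.
apply: Rplus_lt_0_compat.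
  apply: Rmult_lt_0_compat; last exact: pow_lt.
  apply: Rmult_lt_0_compat; last by lra.
  by apply: Rinv_0_lt_compat; apply: pow_lt.
by apply: Rdiv_lt_0_compat; last lra; apply: Rmult_lt_0_compat; lra.
Qed.

(* AM-GM: [eta * (epsc3 - eta * epsc4) <= t - 2 t^2 <= 1/8] for [t = eta * beta]. *)
Lemma epsc10_bounds Lf rho rho2 nu alpha beta eta :
  0 < nu -> 0 < eta -> 0 < rho2 -> 0 < beta -> 0 < alpha ->
  0 < epsc1 Lf rho2 alpha beta - eta * epsc2 Lf rho alpha beta ->
  0 < epsc3 rho2 alpha beta - eta * epsc4 beta ->
  0 <= epsc10 Lf rho rho2 nu alpha beta eta <= 1.
Proof.
move=> nu0 e0 r0 b0 a0 m1 m3; rewrite /epsc10; split.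
  apply: Rmult_le_pos; first by lra.
  by apply: Rmin_glb; [apply: Rmin_glb|]; lra.
apply: (Rle_trans _ (eta * (epsc3 rho2 alpha beta - eta * epsc4 beta))).
  apply: Rmult_le_compat_l; first by lra.
  by apply: Rle_trans (Rmin_l _ _) (Rmin_r _ _).
have : 0 < alpha / (2 * beta ^ 2).
  by apply: Rdiv_lt_0_compat => //; have := pow_lt beta 2 b0; lra.
have : 0 < / (2 * beta * rho2).
  by apply: Rinv_0_lt_compat; apply: Rmult_lt_0_compat; lra.
move=> h1 h2.
have E3 : epsc3 rho2 alpha beta <= beta by rewrite /epsc3; lra.
have := Rmult_le_compat_l eta _ _ (Rlt_le _ _ e0) E3.
have := pow2_ge_0 (eta * beta - 1 / 4); have := pow2_ge_0 eta.
rewrite /epsc4; lra.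
Qed.

Lemma epsc8_ge1 rho2 alpha beta : 0 < rho2 -> 0 < beta -> beta < alpha ->
  (alpha + beta) / (2 * beta) <= epsc8 rho2 alpha beta /\ 1 <= epsc8 rho2 alpha beta.
Proof.
move=> r0 b0 ab.
have : 0 < / (2 * rho2) by apply: Rinv_0_lt_compat; lra.
have : 1 <= (alpha + beta) / (2 * beta).
  apply: (Rmult_le_reg_r (2 * beta)); first by lra.
  by rewrite /Rdiv Rmult_assoc Rinv_l; lra.
by rewrite /epsc8; lra.
Qed.

(** These bounds make the weight [theta] admissible: [epsc9 <= / 2] gives [theta <= 2], and the last
    one gives [theta <= epsc8]. The latter reduces to a quadratic form in [alpha], [beta] with
    negative discriminant. *)
Lemma epsc9_bounds rho alpha beta : 0 < rho -> 0 < beta -> beta < alpha ->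
  0 < epsc9 rho alpha beta <= / 2 /\
  4 * epsc9 rho alpha beta <= (alpha + beta) / (2 * beta).
Proof.
move=> r0 b0 ab; rewrite /epsc9; set q := (alpha - beta) / (2 * alpha).
have q0 : 0 < q by apply: Rdiv_lt_0_compat; lra.
have q2 : q <= / 2.
  apply: (Rmult_le_reg_r (2 * alpha)); first by lra.
  by rewrite /q /Rdiv Rmult_assoc Rinv_l; lra.
have q4 : 4 * q <= (alpha + beta) / (2 * beta).
  have P : 0 < 2 * alpha * beta by apply: Rmult_lt_0_compat; lra.
  have -> : (alpha + beta) / (2 * beta) = 4 * q +
     (alpha ^ 2 - 3 * alpha * beta + 4 * beta ^ 2) / (2 * alpha * beta).
    rewrite /q; field; lra.
  have : 0 <= (alpha ^ 2 - 3 * alpha * beta + 4 * beta ^ 2) / (2 * alpha * beta).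
    apply: Rle_mult_inv_pos => //.
    by have := pow2_ge_0 (alpha - 3 / 2 * beta); have := pow2_ge_0 beta; lra.
  by lra.
have ir : 0 < / (2 * rho) by apply: Rinv_0_lt_compat; lra.
have := Rmin_r (/ (2 * rho)) q; have := Rmin_pos _ _ ir q0; lra.
Qed.

(** [X], [W], [D], [S] are the disagreements of the iterate, the shifted dual, the gradient error
    and the scaled drift; [E], [F], [G] are [n] times the squared averages of the gradient error, of
    the gradients at the average and of the gradients at the iterates. All hypotheses are linear in
    these, so suitable multiples combine linearly. *)
Lemma lyapunov_decrease Lf rho rho2 nu alpha beta eta theta X W D E F G S V V' phi phi' :
  0 < Lf -> 0 < rho2 -> 0 < beta -> 0 < alpha -> 0 < eta -> 0 < nu ->
  0 < epsc5 Lf rho2 alpha beta - eta * epsc6 Lf rho2 alpha beta ->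
  1 <= theta <= 2 ->
  0 <= X -> 0 <= W -> 0 <= D -> 0 <= E -> 0 <= G -> 0 <= phi ->
  V' <= V - eta * (((alpha - beta) * rho2 - 1) * X - D + epsc3 rho2 alpha beta * W
              - beta / 2 * (/ beta + / rho2 + alpha / beta) * S)
     + eta ^ 2 * ((beta ^ 2 * rho + (2 * alpha ^ 2 + beta ^ 2) * rho ^ 2) * X
                  + 2 * D + epsc4 beta * W + (/ rho2 + alpha / beta + 2) * S) ->
  D + E <= Lf ^ 2 * X ->
  S <= Lf ^ 2 * G / beta ^ 2 ->
  phi' <= phi + eta * ((E - F - G) / 2) + eta ^ 2 * (Lf / 2) * G ->
  2 * nu * phi <= F ->
  V' + theta * phi' <= V + theta * phi
     - epsc10 Lf rho rho2 nu alpha beta eta * (X + W + phi).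
Proof.
move=> L0 r0 b0 a0 e0 nu0 m5 [t1 t2] X0 W0 D0 E0 G0 p0 HV HDE HS Hphi HF.
have i2 : 0 < / rho2 by apply: Rinv_0_lt_compat.
have k0 : 0 < alpha / beta by apply: Rdiv_lt_0_compat.
have ib : 0 < / beta by apply: Rinv_0_lt_compat.
set mn := Rmin (Rmin (epsc1 Lf rho2 alpha beta - eta * epsc2 Lf rho alpha beta)
   (epsc3 rho2 alpha beta - eta * epsc4 beta)) (nu / 2).
have M1 : mn <= epsc1 Lf rho2 alpha beta - eta * epsc2 Lf rho alpha beta.
  by apply: Rle_trans (Rmin_l _ _) (Rmin_l _ _).
have M3 : mn <= epsc3 rho2 alpha beta - eta * epsc4 beta.
  by apply: Rle_trans (Rmin_l _ _) (Rmin_r _ _).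
have M5 : mn <= nu / 2 by apply: Rmin_r.
have E10 : epsc10 Lf rho rho2 nu alpha beta eta = eta * mn by [].
have R1 := Rmult_le_compat_l eta _ _ (Rlt_le _ _ e0) (Rmult_le_compat_r _ _ _ X0 M1).
have R3 := Rmult_le_compat_l eta _ _ (Rlt_le _ _ e0) (Rmult_le_compat_r _ _ _ W0 M3).
have R5 := Rmult_le_compat_l eta _ _ (Rlt_le _ _ e0) (Rmult_le_compat_r _ _ _ p0 M5).
set c := Lf ^ 2 / beta ^ 2.
have c0 : 0 < c by apply: Rdiv_lt_0_compat; apply: pow_lt.
set k := / rho2 + alpha / beta.
have kp : 0 < k by rewrite /k; lra.
have HS' : S <= c * G by apply: Rle_trans HS _; rewrite /c; apply: Req_le; field; lra.
have Q1 : eta * (beta / 2 * (/ beta + k) * S) <= eta * (beta / 2 * (/ beta + k) * (c * G)).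
  apply: Rmult_le_compat_l; first by lra.
  apply: Rmult_le_compat_l => //.
  by apply: Rmult_le_pos; lra.
have Q2 : eta ^ 2 * ((k + 2) * S) <= eta ^ 2 * ((k + 2) * (c * G)).
  apply: Rmult_le_compat_l; first exact: pow2_ge_0.
  by apply: Rmult_le_compat_l => //; lra.
have TP := Rmult_le_compat_l theta _ _ ltac:(lra) Hphi.
have TF : eta * (theta / 2 * (2 * nu * phi)) <= eta * (theta / 2 * F).
  by apply: Rmult_le_compat_l; [lra | apply: Rmult_le_compat_l => //; lra].
have np : 0 <= nu * phi by apply: Rmult_le_pos; lra.
have enp : 0 <= eta * (nu * phi) by apply: Rmult_le_pos; lra.
have TN : eta * (nu * phi) <= eta * (theta * (nu * phi)).
  by apply: Rmult_le_compat_l; [lra | have := Rmult_le_compat_r _ _ _ np t1; lra].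
(* Here [theta <= 2] enters: the averaged gradient error then fits into [D + E <= Lf ^ 2 * X], and
   [X] pays for it. *)
have TE : eta * (theta / 2 * E) <= eta * E.
  apply: Rmult_le_compat_l; first by lra.
  by have := Rmult_le_compat_r _ _ _ E0 t2; lra.
have HDE1 := Rmult_le_compat_l eta _ _ (Rlt_le _ _ e0) HDE.
have HDE2 := Rmult_le_compat_l (eta ^ 2) _ _ (pow2_ge_0 eta) HDE.
have eE : 0 <= eta * E by apply: Rmult_le_pos; lra.
have e2E : 0 <= eta ^ 2 * E by apply: Rmult_le_pos => //; apply: pow2_ge_0.
have e2X : 0 <= eta ^ 2 * (Lf ^ 2 * X).
  by apply: Rmult_le_pos; [|apply: Rmult_le_pos => //]; apply: pow2_ge_0.
have eX : 0 <= eta * (Lf ^ 2 * X).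
  by apply: Rmult_le_pos; [lra|apply: Rmult_le_pos => //]; apply: pow2_ge_0.
have eD : 0 <= eta * D by apply: Rmult_le_pos; lra.
have E6 : epsc6 Lf rho2 alpha beta = (1 + k) * c + Lf * (1 + Lf) / 2.
  rewrite /epsc6 /k /c; field; lra.
have E5 : epsc5 Lf rho2 alpha beta = / 4 - beta / 2 * (/ beta + k) * c.
  rewrite /epsc5 /k /c; field; lra.
(* The coefficient of [- eta * G] that remains after the [epsc5] margin has been spent. That margin
   also bounds [eta * c + eta * Lf / 2] by [/ 4], which gives the sign. *)
have gG : 0 <= - / 4 + theta / 2 - eta * ((theta - 1) * Lf / 2 - Lf ^ 2 / 2 + c).
  have h1 : 0 <= beta / 2 * (/ beta + k) * c.
    by apply: Rmult_le_pos; [apply: Rmult_le_pos|]; lra.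
  have h2 : 0 <= eta * (k * c).
    by apply: Rmult_le_pos; [|apply: Rmult_le_pos]; lra.
  have h3 : 0 <= eta * Lf ^ 2 by apply: Rmult_le_pos; [lra | apply: pow2_ge_0].
  have h4 : 0 <= eta * Lf by apply: Rmult_le_pos; lra.
  have h5 : 0 <= eta * c by apply: Rmult_le_pos; lra.
  rewrite E5 E6 in m5.
  have h6 : eta * c + eta * Lf / 2 <= / 4 by lra.
  have : (theta - 1) * (eta * Lf / 2) <= (theta - 1) * / 4.
    by apply: Rmult_le_compat_l; lra.
  lra.
have GG := Rmult_le_pos _ _ (Rlt_le _ _ e0) (Rmult_le_pos _ _ gG G0).
have G5 : 0 <= eta * ((epsc5 Lf rho2 alpha beta - eta * epsc6 Lf rho2 alpha beta) * G).
  by apply: Rmult_le_pos; [lra | apply: Rmult_le_pos; lra].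
rewrite E5 E6 in G5.
rewrite E10; rewrite /epsc1 /epsc2 in R1.
rewrite /k in Q1 Q2 GG G5.
lra.
Qed.

(** * Assembly: dynamics of the average, contraction and the two claims *)

Lemma snorm2Z n p c (z : svec n p) : snorm2 (fun i => vscal c (z i)) = c ^ 2 * snorm2 z.
Proof. by rewrite -sumR_mull; apply: eq_sumR => i; apply: norm2Z. Qed.

Lemma sum_laplacian n (a : 'I_n -> 'I_n -> R) (z : 'I_n -> R) : undirected_weighted a ->
  sumR n (fun i => sumR n (fun j => laplacian a i j * z j)) = 0.
Proof.
move=> Ha; rewrite exchange_sumR; apply: sumR0 => j; rewrite sumR_mulr.
rewrite (eq_sumR _ _ (fun i => laplacian a j i)) ?laplacian_rowsum; first by ring.
by move=> i; apply: laplacian_sym.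
Qed.

Lemma lipschitz_ge0 p (G : vec p -> vec p) Lc (l : 'I_p) : lipschitz G Lc -> 0 <= Lc.
Proof.
move=> H; have := H (fun=> 1) (fun=> 0); have := norm_ge0 p (vsub (G (fun=> 1)) (G (fun=> 0))).
have : 1 <= norm (vsub (fun=> 1 : R) (fun=> 0) : vec p).
  apply: Rle_trans (Rabs_coord_le_norm p _ l).
  by rewrite /vsub Rminus_0_r Rabs_R1; lra.
nra.
Qed.

Lemma ord_or_void p : 'I_p + ('I_p -> False).
Proof. by case: p => [|p]; [right; case | left; exact: ord0]. Qed.

Lemma norm2_void p (y : vec p) : ('I_p -> False) -> norm2 y = 0.
Proof. by move=> p0; apply: sumR0 => l; case: (p0 l). Qed.

Theorem theorem2
  (n p : nat)
  (a : 'I_n -> 'I_n -> R)                      (* graph weights *)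
  (rho rho2 : R)                               (* rho(L), rho_2(L) *)
  (f_ : 'I_n -> vec p -> R) (gf : 'I_n -> vec p -> vec p) (Lf : R)
  (fstar nu : R)
  (kappa2 alpha beta eta : R)
  (x v : nat -> svec n p)
  (* graph and its Laplacian *)
  (Hund : undirected_weighted a)
  (HA1 : connected a)
  (Hrho : is_largest_eig (laplacian a) rho)
  (Hrho2 : is_smallest_pos_eig (laplacian a) rho2)
  (* f = (1/n) sum_i f_i ; (A2): the minimum f* is attained *)
  (HA2 : (exists xs : vec p, / INR n * sumR n (fun i => f_ i xs) = fstar) /\
         forall y : vec p, fstar <= / INR n * sumR n (fun i => f_ i y))
  (* (A3) *)
  (Hgrad : forall i, is_gradient (f_ i) (gf i))
  (HA3 : forall i, lipschitz (gf i) Lf)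
  (* (A4) Polyak–Lojasiewicz *)
  (Hnu : 0 < nu)
  (HA4 : forall gF : vec p -> vec p,
           is_gradient (fun y => / INR n * sumR n (fun i => f_ i y)) gF ->
           forall y : vec p,
             / 2 * norm2 (gF y) >= nu * (/ INR n * sumR n (fun i => f_ i y) - fstar))
  (* parameters as in Theorem 1 *)
  (Hk2 : kappa2 > 1)
  (Hbeta : beta > Rmax (Rmax (kappac1 Lf rho2 / (kappa2 - 1)) (kappac3 rho2 kappa2))
                       (kappac4 Lf rho2 kappa2))
  (Halpha : beta + kappac1 Lf rho2 < alpha /\ alpha <= kappa2 * beta)
  (Heta : 0 < eta /\
          eta < Rmin (Rmin (epsc1 Lf rho2 alpha beta / epsc2 Lf rho alpha beta)
                           (epsc3 rho2 alpha beta / epsc4 beta))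
                     (epsc5 Lf rho2 alpha beta / epsc6 Lf rho2 alpha beta))
  (* Algorithm 1 *)
  (Hv0 : forall l, sumR n (fun j => v 0%nat j l) = 0)
  (Hx : forall k i l,
      x (S k) i l = x k i l - eta * (alpha * sumR n (fun j => laplacian a i j * x k j l)
                                     + beta * v k i l + gf i (x k i) l))
  (Hv : forall k i l,
      v (S k) i l = v k i l + eta * beta * sumR n (fun j => laplacian a i j * x k j l)) :
  let f := fun y : vec p => / INR n * sumR n (fun i => f_ i y) in
  let xbar := fun k => avg (x k) in
  let g00 : svec n p := fun i => gf i (avg (x 0%nat)) in
  let V0 := Kform (x 0%nat)
            + Kform (fun i l => v 0%nat i l + / beta * g00 i l)
            + INR n * (f (avg (x 0%nat)) - fstar) in
  let eps := epsT Lf rho rho2 nu alpha beta eta in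
  let c := epsc8 rho2 alpha beta * V0 / epsc9 rho alpha beta in
  (forall k : nat,
     snorm2 (fun i => vsub (x k i) (xbar k)) + INR n * (f (xbar k) - fstar)
       <= (1 - eps) ^ k * c)
  /\
  ((forall z : vec p, exists! y : vec p,
      f y = fstar /\ forall y', f y' = fstar -> norm2 (vsub z y) <= norm2 (vsub z y')) ->
   forall (k : nat) (y : vec p),
     f y = fstar ->
     (forall y', f y' = fstar -> norm2 (vsub (xbar k) y) <= norm2 (vsub (xbar k) y')) ->
     snorm2 (fun i => vsub (x k i) y) <= (1 - eps) ^ k * c * (1 + / (2 * nu))).
Proof.
move=> f xbar g00 V0 eps c.
have r20 : 0 < rho2 by case: Hrho2.
have r0 : rho2 <= rho by apply: (proj2 Hrho); case: Hrho2 => _ [].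
have n0 : 0 < INR n.
  case: Hrho => [[u [[i _] _]] _]; apply: lt_0_INR; apply/ltP.
  exact: leq_ltn_trans (ltn_ord i).
have k10 := kappac1_gt0 Lf rho2 r20.
have b0 : 0 < beta.
  have := kappac3_gt0 rho2 kappa2.
  have := Rmax_r (kappac1 Lf rho2 / (kappa2 - 1)) (kappac3 rho2 kappa2).
  have := Rmax_l (Rmax (kappac1 Lf rho2 / (kappa2 - 1)) (kappac3 rho2 kappa2))
    (kappac4 Lf rho2 kappa2).
  by lra.
have ab : beta < alpha by lra.
have a0 : 0 < alpha by lra.
have [e0 Heta'] := Heta.
have eta1 : eta < epsc1 Lf rho2 alpha beta / epsc2 Lf rho alpha beta.
  by apply: Rlt_le_trans Heta' _; apply: Rle_trans (Rmin_l _ _) (Rmin_l _ _).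
have eta3 : eta < epsc3 rho2 alpha beta / epsc4 beta.
  by apply: Rlt_le_trans Heta' _; apply: Rle_trans (Rmin_l _ _) (Rmin_r _ _).
have eta5 : eta < epsc5 Lf rho2 alpha beta / epsc6 Lf rho2 alpha beta.
  by apply: Rlt_le_trans Heta' (Rmin_r _ _).
have [[e91 e92] e94] := epsc9_bounds rho alpha beta (Rlt_le_trans _ _ _ r20 r0) b0 ab.
have [e8k e81] := epsc8_ge1 rho2 alpha beta r20 b0 ab.
have gfavg := is_gradient_avg n p f_ gf Hgrad.
have [[xs fxs] fmin] := HA2.
have fge y : fstar <= f y := fmin y.
(* For [p = 0] the Lipschitz hypothesis allows [Lf < 0]. *)
case: (ord_or_void p) => [l0|p0]; last first.
  have vec0 (y z : vec p) : y = z by apply: functional_extensionality => l; case: (p0 l).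
  have fE y : f y = fstar by rewrite (vec0 y xs).
  have V00 : V0 = 0.
    rewrite /V0 fE !KformE // /dev2 /snorm2 !sumR0 => [|i|i]; try exact: norm2_void.
    by ring.
  have c0 : c = 0 by rewrite /c V00 /Rdiv; ring.
  split=> [k|_ k y _ _]; rewrite c0 /snorm2 sumR0 => [|i]; try exact: norm2_void.
    by rewrite fE; lra.
  by lra.
have i0 : 'I_n by apply: (@Ordinal n 0); apply/ltP; apply: INR_lt.
have L0 : 0 < Lf.
  case: (Rle_lt_or_eq_dec 0 Lf (lipschitz_ge0 p (gf i0) Lf l0 (HA3 i0))) => // L0.
  (* [Lf = 0] gives [epsc6 = 0], and [epsc5 / 0 = 0] contradicts [0 < eta]. *)
  move: eta5; rewrite -L0.
  have -> : epsc6 0 rho2 alpha beta = 0 by rewrite /epsc6; field; lra.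
  by rewrite /Rdiv Rinv_0 Rmult_0_r; lra.
have r00 : 0 < rho by lra.
have m1 := eps1_margin Lf rho rho2 alpha beta eta r00 b0 eta1.
have m3 := eps3_margin rho2 alpha beta eta eta3.
have m5 := eps5_margin Lf rho2 alpha beta eta L0 r20 b0 a0 eta5.
have [e100 e101] := epsc10_bounds Lf rho rho2 nu alpha beta eta Hnu e0 r20 b0 a0 m1 m3.
have [N [e [lam [Hlam [He Hz]]]]] := laplacian_eigenframe n a rho rho2 Hund HA1 Hrho Hrho2.
pose theta := Rmax 1 (4 * epsc9 rho alpha beta).
have t1 : 1 <= theta by apply: Rmax_l.
have t4 : 4 * epsc9 rho alpha beta <= theta by apply: Rmax_r.
have t2 : theta <= 2 by apply: Rmax_lub; lra.
have t8 : theta <= epsc8 rho2 alpha beta by apply: Rmax_lub; lra.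
pose w k : svec n p := fun i l => v k i l + / beta * gf i (xbar k) l.
pose phi k := INR n * (f (xbar k) - fstar).
have phi0 k : 0 <= phi k by apply: Rmult_le_pos; [lra | have := fge (xbar k); lra].
pose V k := consensusV alpha beta e lam (x k) (w k) + theta * phi k.
have dev0 (z : svec n p) : 0 <= dev2 z by apply: snorm2_ge0.
have Vlow k : epsc9 rho alpha beta * (dev2 (x k) + dev2 (w k)) + theta * phi k <= V k.
  have := consensusV_lower N n p rho rho2 alpha beta e lam Hlam Hz r20 b0 ab (x k) (w k).
  by rewrite /V; lra.
have Vup k : V k <= epsc8 rho2 alpha beta * (dev2 (x k) + dev2 (w k) + phi k).
  have := consensusV_upper N n p rho rho2 alpha beta e lam Hlam Hz r20 b0 ab (x k) (w k).
  by have := Rmult_le_compat_r _ _ _ (phi0 k) t8; rewrite /V; lra.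
(* The dual variables keep mean zero because Laplacian columns sum to zero; hence the average moves
   along the averaged gradient alone. *)
have vsum k l : sumR n (fun i => v k i l) = 0.
  elim: k => [|k IH]; first exact: Hv0.
  rewrite (eq_sumR _ _ _ (fun i => Hv k i l)) sumRD sumR_mull sum_laplacian // IH; ring.
pose g k : svec n p := fun i => gf i (x k i).
pose g0 k : svec n p := fun i => gf i (xbar k).
have xbarS k : xbar k.+1 = vadd (xbar k) (vscal (- eta) (avg (g k))).
  apply: functional_extensionality => l; rewrite /xbar /avg /vadd /vscal.
  rewrite (eq_sumR _ _ _ (fun i => Hx k i l)) sumRB sumR_mull !sumRD !sumR_mull.
  by rewrite sum_laplacian // vsum /g; ring.
pose d k : svec n p := fun i => vsub (g k i) (g0 k i).
(* With this scaling the shifted dual moves by [eta] times [beta * L x + dl], and the [eta] in the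
   movement of the average cancels, so the bound on [dl] is free of [eta]. *)
pose dl k : svec n p := fun i => vscal (/ (eta * beta)) (vsub (g0 k.+1 i) (g0 k i)).
have Vstep k : V k.+1 <= V k - epsc10 Lf rho rho2 nu alpha beta eta
                 * (dev2 (x k) + dev2 (w k) + phi k).
  apply: (lyapunov_decrease Lf rho rho2 nu alpha beta eta theta _ _ (dev2 (d k))
    (INR n * norm2 (avg (d k))) (INR n * norm2 (avg (g0 k)))
    (INR n * norm2 (avg (g k))) (dev2 (dl k))) => //.
  - by apply: Rmult_le_pos; [lra | apply: norm2_ge0].
  - by apply: Rmult_le_pos; [lra | apply: norm2_ge0].
  - apply: (consensusV_step N n p a rho rho2 alpha beta eta e lam
      Hund Hlam He Hz r20 b0 ab) => // i l.
      rewrite Hx /w /d /vsub /g /g0; field; lra.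
    rewrite /w /dl /vscal /vsub /g0 Hv; field; lra.
  - rewrite dev2E //.
    have : snorm2 (d k) <= Lf ^ 2 * dev2 (x k).
      by rewrite -sumR_mull; apply: sumR_le => i; apply: lipschitz_norm2.
    by lra.
  - rewrite dev2E //; have := norm2_ge0 p (avg (dl k)) => h1.
    have h2 := Rmult_le_pos _ _ (Rlt_le _ _ n0) h1.
    suff : snorm2 (dl k) <= Lf ^ 2 * (INR n * norm2 (avg (g k))) / beta ^ 2 by lra.
    rewrite /dl snorm2Z.
    have : snorm2 (fun i => vsub (g0 k.+1 i) (g0 k i)) <=
           Lf ^ 2 * (INR n * (eta ^ 2 * norm2 (avg (g k)))).
      have -> : Lf ^ 2 * (INR n * (eta ^ 2 * norm2 (avg (g k)))) =
          INR n * (Lf ^ 2 * norm2 (vsub (xbar k.+1) (xbar k))).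
        have -> : vsub (xbar k.+1) (xbar k) = vscal (- eta) (avg (g k)).
          by apply: functional_extensionality => l; rewrite xbarS /vsub /vadd; ring.
        by rewrite norm2Z; ring.
      by rewrite -sumR_const; apply: sumR_le => i; apply: lipschitz_norm2.
    move=> /(Rmult_le_compat_l ((/ (eta * beta)) ^ 2) _ _ (pow2_ge_0 _)).
    by move/Rle_trans; apply; apply: Req_le; field; lra.
  (* The inner product of the two averaged gradients is polarised; since [d] is their difference
     before averaging, this produces [(E - F - G) / 2]. *)
  - have := descent_lemma p f _ Lf (xbar k) (vscal (- eta) (avg (g k))) gfavg
      (lipschitz_avg n p gf Lf n0 (Rlt_le _ _ L0) HA3).
    rewrite -xbarS dotZr norm2Z -/(g0 k).
    have -> : avg (d k) = vsub (avg (g k)) (avg (g0 k)).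
      by apply: functional_extensionality => l; rewrite /d /vsub /avg sumRB; ring.
    rewrite norm2B.
    have -> : dot (avg (g k)) (avg (g0 k)) = dot (avg (g0 k)) (avg (g k)).
      by apply: eq_sumR => l; ring.
    move=> /(Rmult_le_compat_l (INR n) _ _ (Rlt_le _ _ n0)).
    by rewrite /phi; lra.
  have := HA4 _ gfavg (xbar k); rewrite -/(f _) -/(g0 k) => /Rge_le.
  move=> /(Rmult_le_compat_l (INR n) _ _ (Rlt_le _ _ n0)).
  by rewrite /phi; lra.
have epsE : eps * epsc8 rho2 alpha beta = epsc10 Lf rho rho2 nu alpha beta eta.
  rewrite /eps /epsT; field; lra.
have eps0 : 0 <= eps by apply: Rle_mult_inv_pos; lra.
(* Follows from [epsc10 <= 1 <= epsc8]; it keeps [1 - eps] nonnegative, so the contraction can be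
   iterated. *)
have eps1 : eps <= 1.
  by apply: (Rmult_le_reg_r (epsc8 rho2 alpha beta)); lra.
have Vdec k : V k.+1 <= (1 - eps) * V k.
  have := Vstep k; have := Rmult_le_compat_l _ _ _ eps0 (Vup k).
  by rewrite -epsE; lra.
have Vgeo k : V k <= (1 - eps) ^ k * V 0%nat.
  elim: k => [|k IH] /=; first by lra.
  apply: (Rle_trans _ _ _ (Vdec k)); rewrite Rmult_assoc.
  by apply: Rmult_le_compat_l => //; lra.
have V0E : V0 = dev2 (x 0%nat) + dev2 (w 0%nat) + phi 0%nat.
  by rewrite /V0 !KformE.
have Vc k : V k <= epsc9 rho alpha beta * ((1 - eps) ^ k * c).
  apply: (Rle_trans _ _ _ (Vgeo k)).
  have -> : epsc9 rho alpha beta * ((1 - eps) ^ k * c) =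
      (1 - eps) ^ k * (epsc8 rho2 alpha beta * V0).
    rewrite /c; field; lra.
  by rewrite V0E; apply: Rmult_le_compat_l => //; apply: pow_le; lra.
have WX k : 0 <= epsc9 rho alpha beta * dev2 (w k).
  by apply: Rmult_le_pos; [lra | apply: dev0].
split=> [k|_ k y fy Hy].
  apply: (Rmult_le_reg_l (epsc9 rho alpha beta)) => //.
  apply: Rle_trans (Vc k); apply: Rle_trans (Vlow k).
  rewrite -/(dev2 (x k)) -/(phi k).
  have := WX k; have : epsc9 rho alpha beta * phi k <= theta * phi k.
    by apply: Rmult_le_compat_r => //; lra.
  by lra.
have QG : norm2 (vsub (xbar k) y) <= 2 / nu * (f (xbar k) - fstar).
  apply: (quadratic_growth p f _ Lf nu fstar _ _ gfavg
    (lipschitz_avg n p gf Lf n0 (Rlt_le _ _ L0) HA3)) => //.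
  exact: HA4 _ gfavg.
(* Pythagoras: the disagreement is invariant under translation by [y], and the mean part is the
   distance from the average to [y]. *)
have -> : snorm2 (fun i => vsub (x k i) y) = dev2 (x k) + INR n * norm2 (vsub (xbar k) y).
  rewrite dev2E //; set z : svec n p := fun i => vsub (x k i) y.
  have <- : avg z = vsub (xbar k) y.
    apply: functional_extensionality => l; rewrite /z /avg /vsub sumRB sumR_const.
    rewrite /xbar /avg; field; lra.
  have := dev2E n p z n0.
  have <- : dev2 (x k) = dev2 z.
    apply: eq_sumR => i; congr norm2; apply: functional_extensionality => l.
    rewrite /z /avg /vsub sumRB sumR_const; field; lra.
  by rewrite dev2E //; lra.
apply: (Rmult_le_reg_l (epsc9 rho alpha beta)) => //.
have in0 : 0 < / (2 * nu) by apply: Rinv_0_lt_compat; lra.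
have -> : epsc9 rho alpha beta * ((1 - eps) ^ k * c * (1 + / (2 * nu))) =
  epsc9 rho alpha beta * ((1 - eps) ^ k * c) * (1 + / (2 * nu)) by ring.
have nu1 : 0 <= 1 + / (2 * nu) by lra.
apply: (Rle_trans _ _ _ _ (Rmult_le_compat_r _ _ _ nu1 (Vc k))).
apply: (Rle_trans _ _ _ _ (Rmult_le_compat_r _ _ _ nu1 (Vlow k))).
(* Writing [2 / nu] as [4 * / (2 * nu)] isolates the factor 4, which is absorbed after multiplying
   by [epsc9] through [4 * epsc9 <= theta]. *)
have QG' : INR n * norm2 (vsub (xbar k) y) <= 4 * / (2 * nu) * phi k.
  have := Rmult_le_compat_l _ _ _ (Rlt_le _ _ n0) QG.
  have -> : INR n * (2 / nu * (f (xbar k) - fstar)) = 4 * / (2 * nu) * phi k.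
    rewrite /phi; field; lra.
  by [].
have := Rmult_le_compat_l _ _ _ (Rlt_le _ _ e91) QG'.
have iphi : 0 <= / (2 * nu) * phi k by apply: Rmult_le_pos => //; lra.
have := Rmult_le_compat_r _ _ _ iphi t4.
have th0 : 0 <= theta * phi k by apply: Rmult_le_pos => //; lra.
have := Rmult_le_pos _ _ (Rlt_le _ _ in0) (WX k).
have : 0 <= / (2 * nu) * (epsc9 rho alpha beta * dev2 (x k)).
  by apply: Rmult_le_pos; [lra | apply: Rmult_le_pos => //; lra].
by have := WX k; lra.
Qed.
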